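(* Let $M=G/H$ be a homogeneous $3$-$(\alpha,\delta)$-Sasaki manifold with $\delta\neq0$ and reductive decomposition $\mathfrak g=\mathfrak h\oplus\mathfrak m$, $\mathfrak m=\mathcal V\oplus\mathcal H$, as in the context. The Nomizu map $\Lambda^\nabla\colon\mathfrak m\times\mathfrak m\to\mathfrak m$ of the canonical connection $\nabla$ is given by $$\Lambda^\nabla_XY=\begin{cases}\Lambda^{g_N}_XY & X,Y\in\mathcal H,\\ \frac{\beta}{2\delta}[X,Y]_{\mathfrak m} & X,Y\in\mathcal V,\\ [X,Y]_{\mathfrak m}-2\alpha\sum_{i=1}^3\eta_i(X)\varphi_iY & X\in\mathcal V,\ Y\in\mathcal H,\\ 0 & X\in\mathcal H,\ Y\in\mathcal V,\end{cases}$$ where $\beta=2(\delta-2\alpha)$ and $\Lambda^{g_N}\colon\mathcal H\times\mathcal H\to\mathcal H$ is the Nomizu map of the Levi-Civita connection on the homogeneous base of the canonical submersion.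
   Context: An almost contact metric structure $(\varphi,\xi,\eta,g)$ on an odd-dimensional manifold consists of a $(1,1)$-tensor field $\varphi$, a vector field $\xi$, a $1$-form $\eta$ and a Riemannian metric $g$ with $\varphi^2=-I+\eta\otimes\xi$, $\eta(\xi)=1$, $\varphi\xi=0$, $\eta\circ\varphi=0$, $g(\varphi X,\varphi Y)=g(X,Y)-\eta(X)\eta(Y)$. An almost $3$-contact metric manifold $(M,\varphi_i,\xi_i,\eta_i,g)$ is a manifold of dimension $4n+3$ with three almost contact metric structures $(\varphi_i,\xi_i,\eta_i,g)$, $i=1,2,3$, sharing the metric $g$, such that for every even permutation $(ijk)$ of $(123)$: $\varphi_k=\varphi_i\varphi_j-\eta_j\otimes\xi_i=-\varphi_j\varphi_i+\eta_i\otimes\xi_j$, $\xi_k=\varphi_i\xi_j=-\varphi_j\xi_i$, $\eta_k=\eta_i\circ\varphi_j=-\eta_j\circ\varphi_i$. Put $\mathcal V=\langle\xi_1,\xi_2,\xi_3\rangle$, $\mathcal H=\bigcap_i\ker\eta_i$, $\Phi_i(X,Y)=g(X,\varphi_iY)$. It is a $3$-$(\alpha,\delta)$-Sasaki manifold, with real constants $\alpha\neq0$ and $\delta$, if $d\eta_i=2\alpha\Phi_i+2(\alpha-\delta)\eta_j\wedge\eta_k$ for every even permutation $(ijk)$ of $(123)$. Conventions: $d\eta(X,Y)=X(\eta(Y))-Y(\eta(X))-\eta([X,Y])$ and $(\eta\wedge\eta')(X,Y)=\eta(X)\eta'(Y)-\eta(Y)\eta'(X)$. Canonical connection: the unique metric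 connection $\nabla$ with totally skew-symmetric torsion such that $\nabla_X\varphi_i=\beta(\eta_k(X)\varphi_j-\eta_j(X)\varphi_k)$ for all $X$ and every even permutation $(ijk)$ of $(123)$, with $\beta=2(\delta-2\alpha)$. Its torsion $3$-form is $T=2\alpha\sum_i\eta_i\wedge\Phi_i^{\mathcal H}+2(\delta-4\alpha)\,\eta_1\wedge\eta_2\wedge\eta_3$, where $\Phi_i^{\mathcal H}=\Phi_i+\eta_j\wedge\eta_k$. Homogeneous setting: $G$ acts transitively on $M=G/H$ by isometries preserving all $\varphi_i,\xi_i,\eta_i$. For a reductive decomposition $\mathfrak g=\mathfrak h\oplus\mathfrak m$, identify $\mathfrak m\cong T_oM$ at the origin $o=eH$ via $X\mapsto\hat X_o$, where $\hat X$ is the fundamental vector field of $X$; write $\mathfrak m=\mathcal V\oplus\mathcal H$ for the corresponding splitting and regard $\varphi_i,\eta_i$ as tensors on $\mathfrak m$. The canonical submersion (the Riemannian submersion with vertical distribution $\mathcal V$) is $G$-equivariant, with homogeneous base $N$ whose isotropy algebra is $\mathfrak k=\mathfrak h\oplus\mathcal V$; it is assumed that $\mathcal H$ is a reductive complement of $\mathfrak k$ in $\mathfrak g$ (in particular $[\mathcal V,\mathcal H]\subset\mathcal H$), and $\Lambda^{g_N}$ is taken with respect to $\mathfrak g=\mathfrak k\oplus\mathcal H$. Nomizu map: an invariant connection $\nabla$ on a reductive homogeneous space corresponds to the isotropy-equivariant bilinear map $\Lambda^\nabla\colon\mathfrak m\times\mathfrak m\to\mathfrak m$, $\Lambda^\nabla_XY=(\nabla_{\hat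 X}\hat Y-[\hat X,\hat Y])_o$, where $[\hat X,\hat Y]$ is the commutator of vector fields; its torsion at $o$ is $T^\nabla(X,Y)=\Lambda^\nabla_XY-\Lambda^\nabla_YX-[X,Y]_{\mathfrak m}$, where $[\cdot,\cdot]$ is the bracket of $\mathfrak g$ and the subscript denotes projection onto $\mathfrak m$ along $\mathfrak h$. *)

(* Defs.v *)
From HB Require Import structures.
From mathcomp Require Import all_boot all_order all_algebra.
From mathcomp Require Import all_classical all_reals all_analysis.
Set Implicit Arguments.
Unset Strict Implicit.
Unset Printing Implicit Defensive.
Import Order.TTheory GRing.Theory Num.Theory.
Import numFieldNormedType.Exports.
Local Open Scope classical_set_scope.
Local Open Scope ring_scope.

(* In finite dimension, and for open U, this is the usual class C^k: the
   partial derivatives of a C^1 map are continuous, and a map with continuous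
   partial derivatives is differentiable. *)
Fixpoint Ck (R : realType) (V W : normedModType R) (k : nat) (U : set V)
    (f : V -> W) : Prop :=
  match k with
  | 0 => forall x, U x -> {for x, continuous f}
  | k'.+1 => (forall x, U x -> differentiable f x) /\
             (forall v, Ck k' U (fun x => 'D_v f x))
  end.

Definition smooth_on (R : realType) (V W : normedModType R) (U : set V)
  (f : V -> W) : Prop := forall k, Ck k U f.

Record chart (R : realType) (d : nat) (M : topologicalType) := Chart {
  chart_dom : set M;
  chart_map : M -> 'rV[R]_d;
  chart_inv : 'rV[R]_d -> M;
  chart_dom_open : open chart_dom;
  chart_img_open : open (chart_map @` chart_dom);
  chart_mapK : forall p, chart_dom p -> chart_inv (chart_map p) = p;
  chart_map_cont : forall p, chart_dom p -> {for p, continuous chart_map};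
  chart_inv_cont : forall x, (chart_map @` chart_dom) x ->
    {for x, continuous chart_inv} }.

Definition chart_img (R : realType) (d : nat) (M : topologicalType)
  (a : chart R d M) : set 'rV[R]_d := chart_map a @` chart_dom a.

Record manifold (R : realType) (d : nat) := Manifold {
  mfd_space :> topologicalType;
  mfd_hausdorff : hausdorff_space mfd_space;
  mfd_countable : @second_countable mfd_space;
  atlas : set (chart R d mfd_space);
  atlas_cover : forall p : mfd_space, exists2 a, atlas a & chart_dom a p;
  atlas_compat : forall a b, atlas a -> atlas b ->
    smooth_on [set x | chart_img a x /\ chart_dom b (chart_inv a x)]
              (fun x => chart_map b (chart_inv a x)) }.

Arguments atlas {R d} _ _.

Definition smooth_fun (R : realType) (d : nat) (M : manifold R d)
    (f : M -> R) : Prop :=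
  forall a, atlas M a -> smooth_on (chart_img a) (fun x => f (chart_inv a x) : R^o).

Definition smooth_map (R : realType) (d e : nat) (M : manifold R d)
    (N : manifold R e) (F : M -> N) : Prop :=
  continuous F /\
  forall a b, atlas M a -> atlas N b ->
    smooth_on [set x | chart_img a x /\ chart_dom b (F (chart_inv a x))]
              (fun x => chart_map b (F (chart_inv a x))).

(* Smoothness of a map L x M -> N, in the product charts of L x M. *)
Definition smooth_map2 (R : realType) (c d e : nat) (L : manifold R c)
    (M : manifold R d) (N : manifold R e) (F : L -> M -> N) : Prop :=
  continuous (fun z : L * M => F z.1 z.2) /\
  forall a b r, atlas L a -> atlas M b -> atlas N r ->
    smooth_on
      [set z : 'rV[R]_c * 'rV[R]_d | [/\ chart_img a z.1, chart_img b z.2 &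
         chart_dom r (F (chart_inv a z.1) (chart_inv b z.2))]]
      (fun z => chart_map r (F (chart_inv a z.1) (chart_inv b z.2))).

(* Ambient type of the tangent vectors of M: a tangent vector is the derivation
   it defines on smooth functions, extended by 0 to the other functions so that
   tangent vectors may be compared with [=]. *)
Definition vec (R : realType) (d : nat) (M : manifold R d) : Type :=
  (M -> R) -> R^o.

Definition on_smooth (R : realType) (d : nat) (M : manifold R d)
    (v : vec M) : vec M :=
  fun f => if `[< smooth_fun f >] then v f else 0.

Definition tangent (R : realType) (d : nat) (M : manifold R d) (p : M) :
    set (vec M) :=
  [set v | exists2 a, atlas M a /\ chart_dom a p &
     exists w : 'rV[R]_d, v = on_smooth (fun f =>
       'D_w (fun x => f (chart_inv a x) : R^o) (chart_map a p))].

Definition vfield (R : realType) (d : nat) (M : manifold R d)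
    (X : M -> vec M) : Prop :=
  (forall p, tangent p (X p)) /\
  (forall f, smooth_fun f -> smooth_fun (fun p => X p f)).

Definition lie (R : realType) (d : nat) (M : manifold R d)
    (X Y : M -> vec M) : M -> vec M :=
  fun p => on_smooth (fun f => X p (fun q => Y q f) - Y p (fun q => X q f)).

Definition push (R : realType) (d e : nat) (M : manifold R d)
    (N : manifold R e) (F : M -> N) (v : vec M) : vec N :=
  on_smooth (fun f => v (fun p => f (F p))).

(* Tensors are given on the ambient space vec M; only their values on
   tangent vectors matter. *)
Definition one_form (R : realType) (d : nat) (M : manifold R d)
    (eta : M -> vec M -> R) : Prop :=
  (forall p (a : R) u v, tangent p u -> tangent p v ->
     eta p (a *: u + v) = a * eta p u + eta p v) /\
  (forall X, vfield X -> smooth_fun (fun p => eta p (X p))).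

Definition endo_field (R : realType) (d : nat) (M : manifold R d)
    (phi : M -> vec M -> vec M) : Prop :=
  [/\ forall p v, tangent p v -> tangent p (phi p v),
      forall p (a : R) u v, tangent p u -> tangent p v ->
        phi p (a *: u + v) = a *: phi p u + phi p v &
      forall X, vfield X -> vfield (fun p => phi p (X p))].

Definition riem_metric (R : realType) (d : nat) (M : manifold R d)
    (g : M -> vec M -> vec M -> R) : Prop :=
  [/\ forall p (a : R) u v w, tangent p u -> tangent p v -> tangent p w ->
        g p (a *: u + v) w = a * g p u w + g p v w,
      forall p u v, tangent p u -> tangent p v -> g p u v = g p v u,
      forall p u, tangent p u -> u != 0 -> 0 < g p u u &
      forall X Y, vfield X -> vfield Y -> smooth_fun (fun p => g p (X p) (Y p))].

Definition wedge (R : realType) (d : nat) (M : manifold R d)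
    (eta eta' : M -> vec M -> R) (p : M)
    (u v : vec M) : R :=
  eta p u * eta' p v - eta p v * eta' p u.

Definition ext_d (R : realType) (d : nat) (M : manifold R d)
    (eta : M -> vec M -> R) (X Y : M -> vec M)
    (p : M) : R :=
  X p (fun q => eta q (Y q)) - Y p (fun q => eta q (X q)) - eta p (lie X Y p).

Definition connection (R : realType) (d : nat) (M : manifold R d)
    (nab : (M -> vec M) -> (M -> vec M) -> M -> vec M) : Prop :=
  [/\ forall X Y, vfield X -> vfield Y -> vfield (nab X Y),
      forall f X X' Y, smooth_fun f -> vfield X -> vfield X' -> vfield Y ->
        nab (fun p => f p *: X p + X' p) Y =
        (fun p => f p *: nab X Y p + nab X' Y p),
      forall X Y Y', vfield X -> vfield Y -> vfield Y' ->
        nab X (fun p => Y p + Y' p) = (fun p => nab X Y p + nab X Y' p) &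
      forall f X Y, smooth_fun f -> vfield X -> vfield Y ->
        nab X (fun p => f p *: Y p) =
        (fun p => f p *: nab X Y p + X p f *: Y p)].

Definition metric_connection (R : realType) (d : nat) (M : manifold R d)
    (g : M -> vec M -> vec M -> R)
    (nab : (M -> vec M) -> (M -> vec M) -> M -> vec M) : Prop :=
  connection nab /\
  forall X Y Z p, vfield X -> vfield Y -> vfield Z ->
    X p (fun q => g q (Y q) (Z q)) =
    g p (nab X Y p) (Z p) + g p (Y p) (nab X Z p).

Definition torsion (R : realType) (d : nat) (M : manifold R d)
    (nab : (M -> vec M) -> (M -> vec M) -> M -> vec M) (X Y : M -> vec M) :
    M -> vec M :=
  fun p => nab X Y p - nab Y X p - lie X Y p.

Definition skew_torsion (R : realType) (d : nat) (M : manifold R d)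
    (g : M -> vec M -> vec M -> R)
    (nab : (M -> vec M) -> (M -> vec M) -> M -> vec M) : Prop :=
  let T X Y Z p := g p (torsion nab X Y p) (Z p) in
  forall X Y Z p, vfield X -> vfield Y -> vfield Z ->
    T X Y Z p = - T Y X Z p /\ T X Y Z p = - T X Z Y p.

Definition levi_civita (R : realType) (d : nat) (M : manifold R d)
    (g : M -> vec M -> vec M -> R)
    (nab : (M -> vec M) -> (M -> vec M) -> M -> vec M) : Prop :=
  metric_connection g nab /\
  forall X Y p, vfield X -> vfield Y -> torsion nab X Y p = 0.

Definition riem_submersion (R : realType) (d e : nat) (M : manifold R d)
    (N : manifold R e)
    (gM : M -> vec M -> vec M -> R)
    (gN : N -> vec N -> vec N -> R)
    (F : M -> N) : Prop :=
  let normal p := [set u | tangent p u /\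
    forall v, tangent p v -> push F v = 0 -> gM p u v = 0] in
  [/\ smooth_map F,
      forall q, exists p, F p = q,
      forall p w, tangent (F p) w -> exists2 v, tangent p v & push F v = w &
      forall p u v, normal p u -> normal p v ->
        gN (F p) (push F u) (push F v) = gM p u v].

(* Indices 1, 2, 3 are the elements of 'I_3 = Z/3; the even permutations of
   three letters are exactly the cyclic ones. *)
Definition even_perm (i j k : 'I_3) : bool := (j == i + 1) && (k == j + 1).

Record contact3_data (R : realType) (d : nat) (M : manifold R d) :=
  Contact3Data {
  met : M -> vec M -> vec M -> R;
  phi : 'I_3 -> M -> vec M -> vec M;
  xi : 'I_3 -> M -> vec M;
  eta : 'I_3 -> M -> vec M -> R }.

Definition almost_contact_metric (R : realType) (d : nat) (M : manifold R d)
    (g : M -> vec M -> vec M -> R)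
    (ph : M -> vec M -> vec M)
    (x : M -> vec M) (et : M -> vec M -> R) : Prop :=
  [/\ riem_metric g, endo_field ph, vfield x & one_form et] /\
  forall p,
    [/\ forall v, tangent p v -> ph p (ph p v) = - v + et p v *: x p,
        et p (x p) = 1,
        ph p (x p) = 0,
        forall v, tangent p v -> et p (ph p v) = 0 &
        forall u v, tangent p u -> tangent p v ->
          g p (ph p u) (ph p v) = g p u v - et p u * et p v].

Definition almost_3_contact_metric (R : realType) (d : nat)
    (M : manifold R d) (S : contact3_data M) : Prop :=
  (forall i, almost_contact_metric (met S) (phi S i) (xi S i) (eta S i)) /\
  forall i j k p, even_perm i j k ->
    [/\ forall v, tangent p v ->
          phi S k p v = phi S i p (phi S j p v) - eta S j p v *: xi S i p /\
          phi S k p v = - phi S j p (phi S i p v) + eta S i p v *: xi S j p,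
        xi S k p = phi S i p (xi S j p) /\ xi S k p = - phi S j p (xi S i p) &
        forall v, tangent p v ->
          eta S k p v = eta S i p (phi S j p v) /\
          eta S k p v = - eta S j p (phi S i p v)].

Definition fund_form (R : realType) (d : nat) (M : manifold R d)
    (S : contact3_data M) (i : 'I_3) (p : M) (u v : vec M) : R :=
  met S p u (phi S i p v).

Definition sasaki3 (R : realType) (n : nat) (M : manifold R (4 * n + 3))
    (S : contact3_data M) (alpha delta : R) : Prop :=
  [/\ alpha != 0, almost_3_contact_metric S &
      forall i j k, even_perm i j k -> forall X Y p, vfield X -> vfield Y ->
        ext_d (eta S i) X Y p =
          2 * alpha * fund_form S i p (X p) (Y p)
          + 2 * (alpha - delta) * wedge (eta S j) (eta S k) p (X p) (Y p)].

Definition beta (R : realType) (alpha delta : R) : R := 2 * (delta - 2 * alpha).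

(* On a 3-(alpha, delta)-Sasaki manifold these conditions determine nab, and
   hence its torsion. *)
Definition canonical_connection (R : realType) (d : nat) (M : manifold R d)
    (S : contact3_data M) (alpha delta : R)
    (nab : (M -> vec M) -> (M -> vec M) -> M -> vec M) : Prop :=
  [/\ metric_connection (met S) nab, skew_torsion (met S) nab &
      forall i j k, even_perm i j k -> forall X Y p, vfield X -> vfield Y ->
        nab X (fun q => phi S i q (Y q)) p - phi S i p (nab X Y p) =
          beta alpha delta *: (eta S k p (X p) *: phi S j p (Y p)
                               - eta S j p (X p) *: phi S k p (Y p))].

Definition vertical_space (R : realType) (d : nat) (M : manifold R d)
    (S : contact3_data M) (p : M) : set (vec M) :=
  [set v | exists c : 'I_3 -> R, v = \sum_i c i *: xi S i p].

Definition horizontal_space (R : realType) (d : nat) (M : manifold R d)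
    (S : contact3_data M) (p : M) : set (vec M) :=
  [set v | tangent p v /\ forall i, eta S i p v = 0].

Record lieGroup (R : realType) (d : nat) := LieGroup {
  lg_mfd :> manifold R d;
  lg_mul : lg_mfd -> lg_mfd -> lg_mfd;
  lg_one : lg_mfd;
  lg_inv : lg_mfd -> lg_mfd;
  lg_mulA : associative lg_mul;
  lg_mul1 : left_id lg_one lg_mul;
  lg_mulV : left_inverse lg_one lg_inv lg_mul;
  lg_mul_smooth : smooth_map2 lg_mul;
  lg_inv_smooth : smooth_map lg_inv }.

Definition lie_algebra (R : realType) (d : nat) (G : lieGroup R d) :
  set (vec G) := tangent (lg_one G).

Definition left_invariant (R : realType) (d : nat) (G : lieGroup R d)
    (X : vec G) : G -> vec G :=
  fun a => push (lg_mul a) X.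

(* With left-invariant fields the map X |-> fundamental A X below reverses the
   sign of brackets. *)
Definition bracket (R : realType) (d : nat) (G : lieGroup R d)
    (X Y : vec G) : vec G :=
  lie (left_invariant X) (left_invariant Y) (lg_one G).

Definition Ad (R : realType) (d : nat) (G : lieGroup R d) (a : G)
    (X : vec G) : vec G :=
  push (fun b => lg_mul (lg_mul a b) (lg_inv a)) X.

Record smoothAction (R : realType) (d e : nat) (G : lieGroup R d)
    (M : manifold R e) := SmoothAction {
  act :> G -> M -> M;
  act_one : forall p, act (lg_one G) p = p;
  act_mul : forall a b p, act (lg_mul a b) p = act a (act b p);
  act_smooth : smooth_map2 act }.

(* The value at p is the velocity at t = 0 of the curve exp(tX) p. *)
Definition fundamental (R : realType) (d e : nat) (G : lieGroup R d)
    (M : manifold R e) (A : smoothAction G M) (X : vec G) :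
    M -> vec M :=
  fun p => push (fun a => A a p) X.

(* M = G/H as a smooth manifold, H being the stabilizer of o: the action is
   transitive and the projection a |-> a o is a submersion (at the unit, hence
   everywhere by equivariance). *)
Definition homogeneous (R : realType) (d e : nat) (G : lieGroup R d)
    (M : manifold R e) (A : smoothAction G M) (o : M) : Prop :=
  (forall p, exists a, A a o = p) /\
  (forall v, tangent o v ->
     exists2 X, lie_algebra X & fundamental A X o = v).

Definition isometric (R : realType) (d e : nat) (G : lieGroup R d)
    (M : manifold R e) (A : smoothAction G M)
    (g : M -> vec M -> vec M -> R) : Prop :=
  forall a p u v, tangent p u -> tangent p v ->
    g (A a p) (push (A a) u) (push (A a) v) = g p u v.

Definition preserves3 (R : realType) (d e : nat) (G : lieGroup R d)
    (M : manifold R e) (A : smoothAction G M) (S : contact3_data M) : Prop :=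
  forall i a p,
    [/\ forall v, tangent p v ->
          phi S i (A a p) (push (A a) v) = push (A a) (phi S i p v),
        xi S i (A a p) = push (A a) (xi S i p) &
        forall v, tangent p v -> eta S i (A a p) (push (A a) v) = eta S i p v].

(* The Lie algebra of the stabilizer of o, as the kernel of the differential
   at the unit of a |-> a o. *)
Definition isotropy_algebra (R : realType) (d e : nat) (G : lieGroup R d)
    (M : manifold R e) (A : smoothAction G M) (o : M) :
    set (vec G) :=
  [set X | lie_algebra X /\ fundamental A X o = 0].

Definition reductive (R : realType) (d e : nat) (G : lieGroup R d)
    (M : manifold R e) (A : smoothAction G M) (o : M)
    (m : set (vec G)) : Prop :=
  [/\ m `<=` lie_algebra (G := G),
      m 0 /\ forall (a : R) X Y, m X -> m Y -> m (a *: X + Y),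
      forall X, lie_algebra X ->
        exists Y Z, [/\ isotropy_algebra A o Y, m Z & X = Y + Z],
      forall X, isotropy_algebra A o X -> m X -> X = 0 &
      forall a, A a o = o -> forall X, m X -> m (Ad a X)].

(* Inverse of the isomorphism m -> T_o M, X |-> (fundamental A X)_o. *)
Definition to_m (R : realType) (d e : nat) (G : lieGroup R d)
    (M : manifold R e) (A : smoothAction G M) (o : M)
    (m : set (vec G)) (v : vec M) : vec G :=
  xget 0 [set X | m X /\ fundamental A X o = v].

(* Projection of the Lie algebra onto m along the isotropy algebra. *)
Definition proj_m (R : realType) (d e : nat) (G : lieGroup R d)
    (M : manifold R e) (A : smoothAction G M) (o : M)
    (m : set (vec G)) (X : vec G) : vec G :=
  xget 0 [set Y | m Y /\ isotropy_algebra A o (X - Y)].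

Definition nomizu (R : realType) (d e : nat) (G : lieGroup R d)
    (M : manifold R e) (A : smoothAction G M) (o : M)
    (m : set (vec G))
    (nab : (M -> vec M) -> (M -> vec M) -> M -> vec M) (X Y : vec G) :
    vec G :=
  let X' := fundamental A X in let Y' := fundamental A Y in
  to_m A o m (nab X' Y' o - lie X' Y' o).

Definition vert_m (R : realType) (d e : nat) (G : lieGroup R d)
    (M : manifold R e) (A : smoothAction G M) (S : contact3_data M) (o : M)
    (m : set (vec G)) : set (vec G) :=
  [set X | m X /\ vertical_space S o (fundamental A X o)].

Definition hor_m (R : realType) (d e : nat) (G : lieGroup R d)
    (M : manifold R e) (A : smoothAction G M) (S : contact3_data M) (o : M)
    (m : set (vec G)) : set (vec G) :=
  [set X | m X /\ horizontal_space S o (fundamental A X o)].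

Definition phi_m (R : realType) (d e : nat) (G : lieGroup R d)
    (M : manifold R e) (A : smoothAction G M) (S : contact3_data M) (o : M)
    (m : set (vec G)) (i : 'I_3) (Y : vec G) :
    vec G :=
  to_m A o m (phi S i o (fundamental A Y o)).

Definition eta_m (R : realType) (d e : nat) (G : lieGroup R d)
    (M : manifold R e) (A : smoothAction G M) (S : contact3_data M) (o : M)
    (i : 'I_3) (X : vec G) : R :=
  eta S i o (fundamental A X o).

(* Main.v *)
Require Import Defs.
From HB Require Import structures.
From mathcomp Require Import all_boot all_order all_algebra.
From mathcomp Require Import all_classical all_reals all_analysis.
From mathcomp Require Import ring lra.
Import Order.TTheory GRing.Theory Num.Theory.
Import numFieldNormedType.Exports.
Local Open Scope classical_set_scope.
Local Open Scope ring_scope.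
Set Implicit Arguments.
Unset Strict Implicit.
Unset Printing Implicit Defensive.
Local Notation eta := Defs.eta.

(** Write X^ for the fundamental field on M of an element X of the Lie algebra
    of G, and <u, v> for the metric. The Nomizu map is the preimage in m of
      u(X, Y) = (nab_(X^) Y^ - [X^, Y^])_o,
    and a homogeneous space makes this vector computable: [X^, Y^] = - [X, Y]^
    (lie_fundamental), and the derivative along X^ of an invariant tensor
    evaluated on fundamental fields is obtained by bracketing its arguments
    with X (invariant_form1, invariant_form2), which comes from differentiating
    a |-> Ad (a^-1) Y at the unit (Ad_derivative). For a metric connection with
    skew torsion T the Koszul formula becomes (nomizu_koszul)
      2 <u(X, Y), Z> = <[X, Y], Z> - <[X, Z], Y> - <[Y, Z], X> + T(X, Y, Z).

    On a 3-(alpha, delta)-Sasaki manifold, nab phi_i determines nab xi_i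
    (nab_xi), hence eta_i (u(X, Y)) = beta (eta_j /\ eta_k)(X, Y) (eta_nomizu),
    while the structure equation becomes a formula for eta_i ([X, Y])
    (eta_bracket). So T is known as soon as one argument is vertical. On three
    horizontal vectors it vanishes (torsion_form_hor0): since phi is parallel
    in horizontal directions and d eta_i is closed, which here is the Jacobi
    identity, phi acting as a derivation kills the 3-form T; on 3-forms this
    action is injective because phi^2 = - 1.

    A vector at o is determined by its eta_i and its products with horizontal
    vectors (contact3_ext), so each case compares these. The base enters in two
    ways. The fundamental field on N of a vertical X vanishes at the base point;
    hence brackets of vertical elements are vertical (vertical_bracket), and the
    Killing equation of N makes Y |-> [X, Y] skew on horizontal vectors
    (vertical_skew). For X and Y both horizontal, u(X, Y) is horizontal, and the
    Koszul formulas of M and of N have the same terms because the submersion is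
    isometric on horizontal vectors.

    On the analytic side, tangent vectors are directional derivatives in charts,
    and two facts about them carry the argument: the chain rule for maps of
    class C^k (Ck_comp) and the symmetry of second derivatives (derive_comm), in
    the form that derivations in two separate variables commute
    (tangent_comm). *)

(** * Calculus of C^k maps between normed modules *)

Section CkCalculus.
Context {R : realType}.
Implicit Types V W Z : normedModType R.

Lemma Ck_subset V W k (U U' : set V) (f : V -> W) :
  U' `<=` U -> Ck k U f -> Ck k U' f.
Proof.
elim: k f => [|k IH] f sU /=; first by move=> cf x /sU; apply: cf.
by move=> [df Df]; split=> [x /sU|v]; [apply: df|apply: IH].
Qed.

Lemma CkW V W k (U : set V) (f : V -> W) : Ck k.+1 U f -> Ck k U f.
Proof.
elim: k f => [|k IH] f [df Df].
  by move=> x Ux; apply: differentiable_continuous; apply: df.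
by split=> // v; apply: IH.
Qed.

Lemma Ck_continuous V W k (U : set V) (f : V -> W) x :
  Ck k U f -> U x -> {for x, continuous f}.
Proof. by elim: k => [|k IH]; [apply|move=> /CkW]. Qed.

(** Ck constrains f at the points of U only, with derivatives taken in the
    ambient space, so it may be checked point by point. *)
Lemma Ck_local V W k (U : set V) (f : V -> W) :
  (forall x, U x -> Ck k [set x] f) -> Ck k U f.
Proof.
elim: k f => [|k IH] f Uf /=; first by move=> x /Uf; apply.
split=> [x /Uf[dx _]|v]; first exact: dx.
by apply: IH => x /Uf[_]; apply.
Qed.

Lemma near_eq_differentiable V W (f g : V -> W) (x : V) :
  {near x, f =1 g} -> differentiable f x -> differentiable g x.
Proof.
move=> fg df.
have E : g \o shift x = cst (g x) + 'd f x +o_ 0 id.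
  rewrite -(nbhs_singleton fg); apply/eqaddoP => _/posnumP[e].
  have /eqaddoP/(_ e%:num (gt0 e)) := diff_locally df.
  have : \forall y \near (0 : V), f (shift x y) = g (shift x y).
    by move: fg; rewrite (near_shift 0) subr0.
  by apply: filterS2 => y /= fgy; rewrite ![(_ - _) _]/(_ - _) /= fgy.
have Ed := diff_unique (diff_continuous df) E.
apply/diff_locallyP; rewrite Ed; split=> //.
exact: diff_continuous df.
Qed.

Lemma scale_is_bilinear W :
  bilinear_for
    (GRing.Scale.Law.clone _ _ *:%R _) (GRing.Scale.Law.clone _ _ *:%R _)
    (@GRing.scale R W : R -> W -> W).
Proof.
split=> [u'|u] a x y /=.
- by rewrite scalerDl scalerA.
- by rewrite scalerDr !scalerA mulrC.
Qed.

Lemma differentiable_scale V W (h : V -> R^o) (f : V -> W) x :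
  differentiable h x -> differentiable f x ->
  differentiable (fun y => h y *: f y) x.
Proof.
move=> dh df.
pose B := bilinear_isBilinear.Build R R W W _ _ (@GRing.scale R W)
  (scale_is_bilinear W).
pose b : {bilinear R -> W -> W} := HB.pack (@GRing.scale R W) B.
have db : differentiable (fun p : R * W => b p.1 p.2) (h x, f x).
  apply: differentiable_bilin => p; apply: scale_continuous.
exact: (differentiable_comp (differentiable_pair dh df) db).
Qed.

Lemma derive_scale V W (h : V -> R^o) (f : V -> W) x v :
  differentiable h x -> differentiable f x ->
  'D_v (fun y => h y *: f y) x = h x *: 'D_v f x + 'D_v h x *: f x.
Proof.
move=> dh df.
pose B := bilinear_isBilinear.Build R R W W _ _ (@GRing.scale R W)
  (scale_is_bilinear W).
pose b : {bilinear R -> W -> W} := HB.pack (@GRing.scale R W) B.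
have bE p q : b p q = p *: q by [].
move: b bE => b bE {B}.
have cb : continuous (fun p : R * W => b p.1 p.2)
  by move=> p; under eq_fun do rewrite bE; apply: scale_continuous.
have db : differentiable (fun p : R * W => b p.1 p.2) (h x, f x).
  exact: differentiable_bilin.
have dp := differentiable_pair dh df.
rewrite !deriveE //; last exact: differentiable_scale.
have := congr1 (fun F : V -> W => F v) (diff_comp dp db).
have Eb : 'd (fun p : R * W => b p.1 p.2) (h x, f x) =
  (fun q => b (h x) q.2 + b q.1 (f x)) :> (R * W -> W) := diff_bilin _ cb.
rewrite /= Eb.
have -> : 'd (fun y => (h y, f y)) x v = ('d h x v, 'd f x v) by rewrite diff_pair.
rewrite !bE /= => <-; congr ('d _ x v); by apply/funext => y /=; rewrite bE.
Qed.

Lemma Ck_eq V W k (U : set V) (f g : V -> W) :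
  open U -> (forall x, U x -> f x = g x) -> Ck k U f -> Ck k U g.
Proof.
move=> oU; elim: k f g => [|k IH] f g fg /=.
  move=> cf x Ux; have fgx : {near x, f =1 g}.
    by apply: filterS (open_nbhs_nbhs (conj oU Ux)); apply: fg.
  change (g y @[y --> x] --> g x); rewrite -(fg x Ux).
  by apply: cvg_trans (cf x Ux); apply: near_eq_cvg.
have nfg x : U x -> {near x, f =1 g}.
  by move=> Ux; apply: filterS (open_nbhs_nbhs (conj oU Ux)); apply: fg.
move=> [df Df]; split=> [x Ux|v].
  exact: near_eq_differentiable (nfg x Ux) (df x Ux).
by apply: (IH _ _ _ (Df v)) => x Ux; apply: near_eq_derive; apply: nfg.
Qed.

Lemma Ck_cst V W k (U : set V) (c : W) : Ck k U (fun _ => c).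
Proof.
elim: k c => [|k IH] c /=; first by move=> x _; apply: cst_continuous.
split=> [x _|v]; first exact: differentiable_cst.
have -> : (fun x => 'D_v (fun _ : V => c) x) = fun _ => 0.
  by apply/funext => x; apply: derive_cst.
exact: IH.
Qed.

Lemma CkD V W k (U : set V) (f g : V -> W) :
  open U -> Ck k U f -> Ck k U g -> Ck k U (fun x => f x + g x).
Proof.
move=> oU; elim: k f g => [|k IH] f g.
  by move=> cf cg x Ux; apply: cvgD; [apply: cf|apply: cg].
move=> [df Df] [dg Dg]; split=> [x Ux|v].
  by apply: differentiableD; [apply: df|apply: dg].
apply: (@Ck_eq _ _ _ _ (fun x => 'D_v f x + 'D_v g x)) => //;
  last exact: (IH _ _ (Df v) (Dg v)).
by move=> x /[dup] /df/diff_derivable dfx /dg/diff_derivable dgx; rewrite -deriveD.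
Qed.

Lemma CkZ V W k (U : set V) (h : V -> R^o) (f : V -> W) :
  open U -> Ck k U h -> Ck k U f -> Ck k U (fun x => h x *: f x).
Proof.
move=> oU; elim: k h f => [|k IH] h f.
  by move=> ch cf x Ux; apply: cvgZ; [apply: ch|apply: cf].
move=> Ch Cf; have [dh Dh] := Ch; have [df Df] := Cf; split=> [x Ux|v].
  by apply: differentiable_scale; [apply: dh|apply: df].
apply: (@Ck_eq _ _ _ _ (fun x => h x *: 'D_v f x + 'D_v h x *: f x)) => //.
  by move=> x Ux; rewrite derive_scale//; [apply: dh|apply: df].
exact: (CkD oU (IH _ _ (CkW Ch) (Df v)) (IH _ _ (Dh v) (CkW Cf))).
Qed.

Lemma Ck_sum V W k (U : set V) (I : finType) (f : I -> V -> W) :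
  open U -> (forall i, Ck k U (f i)) -> Ck k U (fun x => \sum_i f i x).
Proof.
move=> oU Cf; elim: (index_enum I) => [|i s IH].
  by apply: (Ck_eq oU _ (Ck_cst k U 0)) => x _; rewrite big_nil.
by apply: (Ck_eq oU _ (CkD oU (Cf i) IH)) => x _; rewrite big_cons.
Qed.

Lemma derive_linear V W (l : {linear V -> W}) x v :
  continuous l -> 'D_v l x = l v.
Proof.
by move=> cl; rewrite deriveE ?diff_lin //; apply: linear_differentiable.
Qed.

Lemma derive_comp V W Z (g : W -> Z) (f : V -> W) x v :
  differentiable f x -> differentiable g (f x) ->
  'D_v (fun y => g (f y)) x = 'D_('D_v f x) g (f x).
Proof.
move=> df dg; rewrite [LHS]deriveE; last exact: (differentiable_comp df dg).
have := congr1 (fun F : V -> Z => F v) (diff_comp df dg).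
by rewrite /= !deriveE.
Qed.

Lemma derive_comp_linear V W Z (l : {linear W -> Z}) (f : V -> W) x v :
  continuous l -> differentiable f x -> 'D_v (fun y => l (f y)) x = l ('D_v f x).
Proof.
move=> cl df; have dl : differentiable l (f x) by apply: linear_differentiable.
by rewrite (derive_comp v df dl) derive_linear.
Qed.

Lemma Ck_linear_comp V W Z k (U : set V) (l : {linear W -> Z}) (f : V -> W) :
  open U -> continuous l -> Ck k U f -> Ck k U (fun x => l (f x)).
Proof.
move=> oU cl; elim: k f => [|k IH] f.
  by move=> cf x Ux; apply: continuous_comp; [apply: cf|apply: cl].
move=> [df Df]; split=> [x Ux|v].
  by apply: differentiable_comp; [apply: df|apply: linear_differentiable].
apply: (@Ck_eq _ _ _ _ (fun x => l ('D_v f x))) => //; last exact: (IH _ (Df v)).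
by move=> x Ux; rewrite derive_comp_linear//; apply: df.
Qed.

Lemma Ck_linear V W k (U : set V) (l : {linear V -> W}) :
  continuous l -> Ck k U l.
Proof.
case: k => [|k] cl; first by move=> x _; apply: cl.
split=> [x _|v]; first exact: linear_differentiable.
have -> : (fun x => 'D_v l x) = fun _ => l v.
  by apply/funext => x; apply: derive_linear.
exact: Ck_cst.
Qed.

(** A basis with continuous coordinates. The chain rule expands a derivative
    along the variable direction 'D_v f x into derivatives along the e i. *)
Definition finite_frame W := exists (I : finType) (e : I -> W)
  (l : I -> {linear W -> R^o}),
  (forall i, continuous (l i)) /\ forall w, w = \sum_i l i w *: e i.

(** The derivative of the composite is sum_i l_i ('D_v f) ('D_(e i) g o f): as
    the directions e i are fixed, induction applies to each 'D_(e i) g. *)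
Lemma Ck_comp V W Z k (U : set V) (U' : set W) (f : V -> W) (g : W -> Z) :
  finite_frame W -> open U -> open U' -> (forall x, U x -> U' (f x)) ->
  Ck k U f -> Ck k U' g -> Ck k U (fun x => g (f x)).
Proof.
move=> [I [e [l [cl le]]]] oU oU' fU.
elim: k g => [|k IH] g.
  by move=> cf cg x Ux; apply: continuous_comp; [apply: cf|apply/cg/fU].
move=> Cf [dg Dg]; have [df Df] := Cf; split=> [x Ux|v].
  by apply: differentiable_comp; [apply: df|apply/dg/fU].
apply: (@Ck_eq _ _ _ _
  (fun x => \sum_i (l i ('D_v f x) : R^o) *: 'D_(e i) g (f x))) => //.
  move=> x Ux; have dgx := dg _ (fU _ Ux);
    rewrite [RHS](derive_comp v (df x Ux) dgx).
  rewrite [in RHS](le ('D_v f x)) [RHS]deriveE // raddf_sum.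
  by apply: eq_bigr => i _; rewrite /= linearZZ (@deriveE _ _ _ g _ _ dgx).
apply: Ck_sum => // i; apply: CkZ => //.
  exact: (Ck_linear_comp oU (cl i) (Df v)).
exact: (IH _ (CkW Cf) (Dg _)).
Qed.

Lemma linear_packed V W (f : V -> W) :
  linear f -> exists l : {linear V -> W}, (l : V -> W) = f.
Proof.
move=> lf; pose fM := GRing.isLinear.Build _ _ _ _ _ lf.
by exists (HB.pack f fM : {linear V -> W}).
Qed.

Lemma finite_frame_of W (I : finType) (e : I -> W) (l : I -> W -> R^o) :
  (forall i, linear (l i)) -> (forall i, continuous (l i)) ->
  (forall w, w = \sum_i l i w *: e i) -> finite_frame W.
Proof.
move=> ll cl el.
have [L HL] := choice (fun i => linear_packed (ll i)).
exists I, e, L; split=> [i|w]; first by rewrite HL.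
by rewrite {1}(el w); apply: eq_bigr => i _; rewrite HL.
Qed.

Lemma finite_frame_rV n : finite_frame 'rV[R]_n.
Proof.
apply: (@finite_frame_of _ 'I_n (fun i => delta_mx 0 i) (fun i w => w 0 i)).
- by move=> i a u v; rewrite !mxE.
- by move=> i; apply: coord_continuous.
- by move=> w; apply: row_sum_delta.
Qed.

Lemma finite_frame_prod W Z : finite_frame W -> finite_frame Z ->
  finite_frame (W * Z)%type.
Proof.
move=> [I [e [l [cl le]]]] [J [e' [l' [cl' le']]]].
apply: (@finite_frame_of _ (I + J)%type
  (fun k => match k with inl i => (e i, 0) | inr j => (0, e' j) end)
  (fun k w => match k with inl i => l i w.1 | inr j => l' j w.2 end)).
- by move=> [i|j] a u v /=; rewrite linearP.
- move=> [i|j] w; first by apply: continuous_comp; [apply: cvg_fst|apply: cl].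
  by apply: continuous_comp; [apply: cvg_snd|apply: cl'].
- move=> w; rewrite big_sumType /=.
  have F1 K (F : K -> W * Z) (r : seq K) :
    (\sum_(k <- r) F k).1 = \sum_(k <- r) (F k).1.
    exact: (big_morph fst (fun _ _ => erefl) erefl).
  have F2 K (F : K -> W * Z) (r : seq K) :
    (\sum_(k <- r) F k).2 = \sum_(k <- r) (F k).2.
    exact: (big_morph snd (fun _ _ => erefl) erefl).
  rewrite [LHS]surjective_pairing [RHS]surjective_pairing; congr pair => /=.
    rewrite F1 F1 /= {1}(le w.1) [X in _ + X]big1 ?addr0 // => j _.
    by rewrite scaler0.
  rewrite F2 F2 /= {1}(le' w.2) [X in X + _]big1 ?add0r // => j _.
  by rewrite scaler0.
Qed.

(** Smoothness on a whole neighbourhood of x, so that it passes to derivatives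
    and composites. *)
Definition smooth_at V W (f : V -> W) (x : V) :=
  exists U : set V, [/\ open U, U x & smooth_on U f].

Lemma smooth_on_at V W (U : set V) (f : V -> W) x :
  open U -> smooth_on U f -> U x -> smooth_at f x.
Proof. by move=> oU sf Ux; exists U. Qed.

Lemma smooth_at_on V W (U : set V) (f : V -> W) :
  (forall x, U x -> smooth_at f x) -> smooth_on U f.
Proof.
move=> sf k; apply: Ck_local => x /sf[U' [_ U'x /(_ k)]].
by apply: Ck_subset => y ->.
Qed.

Lemma near_eq_smooth_at V W (f g : V -> W) x :
  {near x, f =1 g} -> smooth_at f x -> smooth_at g x.
Proof.
move=> fg [U [oU Ux sf]]; exists (U `&` interior [set y | f y = g y]); split.
- by apply: openI => //; apply: open_interior.
- by split => //; apply: fg.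
- move=> k; have oI : open (U `&` interior [set y | f y = g y]).
    by apply: openI => //; apply: open_interior.
  apply: (Ck_eq oI (f := f)); first by move=> y [_ /interior_subset].
  by apply: Ck_subset (sf k) => y [].
Qed.

Lemma eq_smooth_at V W (f g : V -> W) x : f =1 g -> smooth_at f x -> smooth_at g x.
Proof. by move=> /funext ->. Qed.

Lemma smooth_at_differentiable V W (f : V -> W) x :
  smooth_at f x -> differentiable f x.
Proof. by move=> [U [_ Ux /(_ 1%N)[+ _]]]; apply. Qed.

Lemma smooth_at_continuous V W (f : V -> W) x :
  smooth_at f x -> {for x, continuous f}.
Proof. by move=> /smooth_at_differentiable/differentiable_continuous. Qed.

Lemma smooth_at_near V W (f : V -> W) x :
  smooth_at f x -> \forall y \near x, smooth_at f y.
Proof.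
move=> [U [oU Ux sf]]; apply: filterS (open_nbhs_nbhs (conj oU Ux)) => y Uy.
by exists U.
Qed.

Lemma smooth_at_derive V W (f : V -> W) x v :
  smooth_at f x -> smooth_at ('D_v f) x.
Proof.
by move=> [U [oU Ux sf]]; exists U; split=> // k; have [_] := sf k.+1; apply.
Qed.

Lemma smooth_at_cst V W (c : W) (x : V) : smooth_at (fun _ => c) x.
Proof. by exists setT; split=> //; [exact: openT|move=> k; exact: Ck_cst]. Qed.

Lemma smooth_at_linear V W (l : {linear V -> W}) x :
  continuous l -> smooth_at l x.
Proof.
by move=> cl; exists setT; split=> //; [exact: openT|move=> k; exact: Ck_linear].
Qed.

Lemma smooth_at_linear_fun V W (l : V -> W) x :
  linear l -> continuous l -> smooth_at l x.
Proof.
by move=> /linear_packed[L <-]; apply: smooth_at_linear.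
Qed.

Lemma smooth_atD V W (f g : V -> W) x :
  smooth_at f x -> smooth_at g x -> smooth_at (fun y => f y + g y) x.
Proof.
move=> [U [oU Ux sf]] [U' [oU' U'x sg]]; exists (U `&` U'); split=> //.
  exact: openI.
move=> k; apply: CkD; first exact: openI.
  by apply: Ck_subset (sf k) => y [].
by apply: Ck_subset (sg k) => y [].
Qed.

Lemma smooth_atZ V W (h : V -> R^o) (f : V -> W) x :
  smooth_at h x -> smooth_at f x -> smooth_at (fun y => h y *: f y) x.
Proof.
move=> [U [oU Ux sf]] [U' [oU' U'x sg]]; exists (U `&` U'); split=> //.
  exact: openI.
move=> k; apply: CkZ; first exact: openI.
  by apply: Ck_subset (sf k) => y [].
by apply: Ck_subset (sg k) => y [].
Qed.

Lemma smooth_at_comp V W Z (f : V -> W) (g : W -> Z) x :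
  finite_frame W -> smooth_at f x -> smooth_at g (f x) ->
  smooth_at (fun y => g (f y)) x.
Proof.
move=> fr [U [oU Ux sf]] [U' [oU' U'x sg]].
have oI : open (U `&` f @^-1` U').
  rewrite openE => y [Uy U'y]; apply: filterI; first exact: open_nbhs_nbhs.
  by apply: (Ck_continuous (sf 0%N) Uy); apply: open_nbhs_nbhs.
exists (U `&` f @^-1` U'); split=> // k.
apply: (Ck_comp fr oI oU' _ _ (sg k)); first by move=> y [].
by apply: Ck_subset (sf k) => y [].
Qed.

Lemma smooth_at_pair V W Z (f : V -> W) (g : V -> Z) x :
  finite_frame W -> finite_frame Z ->
  smooth_at f x -> smooth_at g x -> smooth_at (fun y => (f y, g y)) x.
Proof.
move=> fW fZ sf sg.
pose l1 (w : W) : W * Z := (w, 0); pose l2 (z : Z) : W * Z := (0, z).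
have L1 : linear l1 by move=> a u v;
  rewrite /l1 [RHS]surjective_pairing /= scaler0 addr0.
have L2 : linear l2 by move=> a u v;
  rewrite /l2 [RHS]surjective_pairing /= scaler0 addr0.
have c1 : continuous l1.
  by move=> w; apply: cvg_pair; [exact: cvg_id|exact: cvg_cst].
have c2 : continuous l2.
  by move=> w; apply: cvg_pair; [exact: cvg_cst|exact: cvg_id].
apply: (@near_eq_smooth_at _ _ (fun y => l1 (f y) + l2 (g y))).
  apply: nearW => y; rewrite /l1 /l2 [LHS]surjective_pairing /=.
  by rewrite addr0 add0r.
apply: smooth_atD.
  exact: (smooth_at_comp fW sf (smooth_at_linear_fun _ L1 c1)).
exact: (smooth_at_comp fZ sg (smooth_at_linear_fun _ L2 c2)).
Qed.

Lemma is_derive_line V W (f : V -> W) (z u : V) (s : R) :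
  differentiable f (z + s *: u) ->
  is_derive s 1 (fun r : R => f (z + r *: u)) ('D_u f (z + s *: u)).
Proof.
move=> df.
have dl : is_diff s (cst z + ( *:%R ^~ u : R -> V)) (0 + ( *:%R ^~ u : R -> V)).
  exact: is_diffD.
have dd := @ex_diff _ _ _ _ _ _ _ dl.
apply: DeriveDef.
  apply: diff_derivable; exact: (differentiable_comp dd df).
rewrite (derive_comp (1 : R) dd df); congr ('D_ _ f _).
by rewrite deriveE // diff_val /= add0r scale1r.
Qed.

(** The mean value theorem, first in the direction u, then in the direction v. *)
Lemma second_difference V (f : V -> R^o) (z u v : V) (t : R) : 0 < t ->
  (forall r s, 0 <= r <= t -> 0 <= s <= t -> smooth_at f (z + r *: u + s *: v)) ->
  exists r s, [/\ 0 <= r <= t, 0 <= s <= t &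
    f (z + t *: u + t *: v) - f (z + t *: u) - (f (z + t *: v) - f z) =
    t ^+ 2 * 'D_v ('D_u f) (z + r *: u + s *: v)].
Proof.
move=> t0 sf.
have tt : 0 <= t <= t by rewrite lexx ltW.
have t00 : 0 <= (0 : R) <= t by rewrite lexx ltW.
have inI (x : R) : x \in `[0, t] -> 0 <= x <= t by rewrite in_itv.
have inO (x : R) : x \in `]0, t[ -> 0 <= x <= t.
  by rewrite in_itv /= => /andP[/ltW -> /ltW ->].
pose p r := f (z + t *: v + r *: u) - f (z + r *: u).
pose dp r := 'D_u f (z + t *: v + r *: u) - 'D_u f (z + r *: u).
have dpP r : 0 <= r <= t -> is_derive r 1 (p : R -> R) (dp r).
  move=> rt; apply: is_deriveB; apply: is_derive_line.
    by rewrite addrAC; apply/smooth_at_differentiable/sf.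
  by apply: smooth_at_differentiable; have := sf r 0 rt t00; rewrite scale0r addr0.
have [||r rI Er] := @MVT R p dp 0 t t0; first by move=> r /inO; apply: dpP.
  by apply: derivable_within_continuous => x /inI /dpP.
pose q s := 'D_u f (z + r *: u + s *: v).
pose dq s := 'D_v ('D_u f) (z + r *: u + s *: v).
have rt := inO _ rI.
have dqP s : 0 <= s <= t -> is_derive s 1 (q : R -> R) (dq s).
  move=> st; apply: is_derive_line; apply: smooth_at_differentiable.
  by apply: smooth_at_derive; apply: sf.
have [||s sI Es] := @MVT R q dq 0 t t0; first by move=> x /inO; apply: dqP.
  by apply: derivable_within_continuous => x /inI /dqP.
exists r, s; split=> //; first exact: inO.
move: Er Es; rewrite /p /dp /q /dq !subr0 !scale0r !addr0 => Er Es.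
rewrite [z + t *: u + _]addrAC Er [z + t *: v + _]addrAC Es.
by rewrite -mulrA -expr2 mulrC.
Qed.

(** Distinct limits have disjoint neighbourhoods, which excludes common values
    of h1 and h2 near z. *)
Lemma limit_eq_of_common_values V W (h1 h2 : V -> W) (z : V) :
  {for z, continuous h1} -> {for z, continuous h2} ->
  (forall A, nbhs z A -> exists y1 y2, [/\ A y1, A y2 & h1 y1 = h2 y2]) ->
  h1 z = h2 z.
Proof.
move=> c1 c2 H; apply: norm_hausdorff => A B nA nB.
have hA : nbhs z (h1 @^-1` A) := c1 _ nA.
have hB : nbhs z (h2 @^-1` B) := c2 _ nB.
have [y1 [y2 [[Ay1 _] [_ By2] E]]] := H _ (filterI hA hB).
by exists (h1 y1); split=> //; rewrite E.
Qed.

Lemma near_box V (z u v : V) (A : set V) : nbhs z A ->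
  exists2 t : R, 0 < t & forall r s, 0 <= r <= t -> 0 <= s <= t ->
    A (z + r *: u + s *: v).
Proof.
move=> zA.
have cm : {for (0, 0), continuous (fun p : R * R => z + p.1 *: u + p.2 *: v)}.
  apply: cvgD; last by apply: cvgZr_tmp; apply: cvg_snd.
  by apply: cvgD; [apply: cvg_cst|apply: cvgZr_tmp; apply: cvg_fst].
have N : nbhs (z + (0 : R, 0 : R).1 *: u + (0 : R, 0 : R).2 *: v) A.
  by rewrite /= !scale0r !addr0.
have /nbhs_ballP[d /= d0 Hd] := cm _ N.
exists (d / 2); first by rewrite divr_gt0.
move=> r s /andP[r0 rd] /andP[s0 sd]; apply: (Hd (r, s)).
have d2 : d / 2 < d by rewrite ltr_pdivrMr // ltr_pMr // ltr1n.
by split; rewrite /ball /= sub0r normrN ger0_norm //; apply: le_lt_trans d2.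
Qed.

(** One second difference equals t^2 times either mixed derivative, taken at
    points that tend to z with t. *)
Lemma derive_comm V (f : V -> R^o) (z u v : V) :
  smooth_at f z -> 'D_u ('D_v f) z = 'D_v ('D_u f) z.
Proof.
move=> sf;
  apply: (@limit_eq_of_common_values _ _ ('D_u ('D_v f)) ('D_v ('D_u f)) z).
- exact: (smooth_at_continuous (smooth_at_derive u (smooth_at_derive v sf))).
- exact: (smooth_at_continuous (smooth_at_derive v (smooth_at_derive u sf))).
move=> A zA.
have [t t0 H] := near_box u v (filterI zA (smooth_at_near sf)).
have [|r [s [rt st E1]]] := @second_difference V f z u v t t0.
  by move=> r s rt st; have [] := H r s rt st.
have [|r' [s' [rt' st' E2]]] := @second_difference V f z v u t t0.
  by move=> r' s' rt' st'; rewrite addrAC; have [] := H s' r' st' rt'.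
exists (z + r' *: v + s' *: u), (z + r *: u + s *: v); split.
- by rewrite addrAC; have [] := H s' r' st' rt'.
- by have [] := H r s rt st.
have tn : t ^+ 2 != 0 by rewrite expf_neq0 // gt_eqF.
apply: (mulfI tn); refine (etrans (esym E2) (etrans _ E1)).
rewrite [z + t *: v + t *: u]addrAC.
by rewrite !opprB addrACA [RHS]addrACA; congr (_ + _); rewrite addrC.
Qed.
End CkCalculus.

(** * Charts, smooth maps and tangent vectors *)

Section Charts.
Context {R : realType} {d : nat} {M : topologicalType}.
Implicit Types (a : chart R d M) (p : M) (x : 'rV[R]_d).

Lemma chart_img_map a p : chart_dom a p -> chart_img a (chart_map a p).
Proof. by exists p. Qed.

Lemma near_chart_img a p : chart_dom a p ->
  \forall x \near chart_map a p, chart_img a x.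
Proof.
move=> ap; apply: open_nbhs_nbhs; split; first exact: chart_img_open.
exact: chart_img_map.
Qed.

Lemma near_chart_inv a p (P : set M) : chart_dom a p ->
  (\forall q \near p, P q) -> \forall x \near chart_map a p, P (chart_inv a x).
Proof.
move=> ap Pp; apply: (chart_inv_cont (chart_img_map ap)).
by rewrite chart_mapK.
Qed.

Lemma near_chart_dom a p : chart_dom a p -> \forall q \near p, chart_dom a q.
Proof. by move=> ap; apply: open_nbhs_nbhs; split=> //; apply: chart_dom_open. Qed.

End Charts.

Section SmoothFunctions.
Context {R : realType} {d : nat} {M : manifold R d}.
Implicit Types (f g : M -> R) (p : M).

Lemma smooth_fun_at f (a : chart R d M) p :
  smooth_fun f -> atlas M a -> chart_dom a p ->
  smooth_at (fun x => f (chart_inv a x) : R^o) (chart_map a p).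
Proof.
move=> sf aa ap; apply: smooth_on_at (sf a aa) _; first exact: chart_img_open.
exact: chart_img_map.
Qed.

Lemma chart_change_smooth (a b : chart R d M) p :
  atlas M a -> atlas M b -> chart_dom a p -> chart_dom b p ->
  smooth_at (fun x => chart_map b (chart_inv a x)) (chart_map a p).
Proof.
move=> aa bb ap bp; apply: smooth_on_at (atlas_compat aa bb) _; last first.
  by split; [exact: chart_img_map|rewrite chart_mapK].
rewrite openE => _ [[q aq <-]]; rewrite chart_mapK // => bq.
apply: filterI; first exact: near_chart_img.
by apply: near_chart_inv => //; apply: near_chart_dom.
Qed.

(** Changes of charts are smooth, so one chart around each point decides. *)
Lemma smooth_fun_local f :
  (forall p, exists a, [/\ atlas M a, chart_dom a p &
     smooth_at (fun x => f (chart_inv a x) : R^o) (chart_map a p)]) ->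
  smooth_fun f.
Proof.
move=> H b bb; apply: smooth_at_on => _ [p bp <-].
have [a [aa ap sf]] := H p.
apply: (near_eq_smooth_at (f := fun x =>
    (fun y => f (chart_inv a y) : R^o) (chart_map a (chart_inv b x)))).
  have := near_chart_inv bp (near_chart_dom ap).
  by apply: filterS => x ax; rewrite /= chart_mapK.
apply: (smooth_at_comp (g := fun y => f (chart_inv a y) : R^o)).
- exact: finite_frame_rV.
- exact: chart_change_smooth.
- by rewrite chart_mapK.
Qed.

Lemma smooth_fun_cst (c : R) : smooth_fun (fun _ : M => c).
Proof. by move=> a aa k; apply: Ck_cst. Qed.

End SmoothFunctions.

Section SmoothMaps.
Context {R : realType} {d e : nat} {M : manifold R d} {N : manifold R e}.
Implicit Types (F : M -> N).

Lemma smooth_map_at F (a : chart R d M) (b : chart R e N) p :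
  smooth_map F -> atlas M a -> atlas N b -> chart_dom a p ->
  chart_dom b (F p) ->
  smooth_at (fun x => chart_map b (F (chart_inv a x))) (chart_map a p).
Proof.
move=> [cF sF] aa bb ap bp; apply: smooth_on_at (sF a b aa bb) _; last first.
  by split; [exact: chart_img_map|rewrite chart_mapK].
rewrite openE => _ [[q aq <-]]; rewrite chart_mapK // => bq.
apply: filterI; first exact: (near_chart_img aq).
apply: (near_chart_inv (P := fun q => chart_dom b (F q)) aq).
exact: (cF _ _ (near_chart_dom bq)).
Qed.

Lemma near_pull F (f : N -> R) (a : chart R d M) (b : chart R e N) p :
  continuous F -> chart_dom a p -> chart_dom b (F p) ->
  \forall x \near chart_map a p,
    f (chart_inv b (chart_map b (F (chart_inv a x)))) = f (F (chart_inv a x)).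
Proof.
move=> cF ap bp; apply: (near_chart_inv (P := fun q =>
  f (chart_inv b (chart_map b (F q))) = f (F q))) => //.
have nb : \forall q \near p, chart_dom b (F q) := cF _ _ (near_chart_dom bp).
by apply: filterS nb => q bq; rewrite chart_mapK.
Qed.

Lemma smooth_fun_comp F (f : N -> R) :
  smooth_map F -> smooth_fun f -> smooth_fun (fun p => f (F p)).
Proof.
move=> sF sf; apply: smooth_fun_local => p.
have [a aa ap] := atlas_cover p; have [b bb bp] := atlas_cover (F p).
exists a; split=> //; have [cF _] := sF.
apply: near_eq_smooth_at (near_pull f cF ap bp) _.
apply: (smooth_at_comp (g := fun y => f (chart_inv b y) : R^o)).
- exact: finite_frame_rV.
- exact: smooth_map_at.
- by rewrite chart_mapK //; apply: smooth_fun_at.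
Qed.
End SmoothMaps.

Section TangentVectors.
Context {R : realType} {d : nat} {M : manifold R d}.
Implicit Types (f g : M -> R) (p : M) (a b : chart R d M) (u v : vec M).

Definition chart_vec a p (w : 'rV[R]_d) : vec M := on_smooth (fun f =>
  'D_w (fun x => f (chart_inv a x) : R^o) (chart_map a p)).

Lemma on_smoothE v f : smooth_fun f -> on_smooth v f = v f.
Proof. by move=> sf; rewrite /on_smooth asboolT. Qed.

Lemma on_smooth_ext u v :
  (forall f, smooth_fun f -> u f = v f) -> on_smooth u = on_smooth v.
Proof.
move=> uv; apply/funext => f; rewrite /on_smooth.
by case: asboolP => // /uv.
Qed.

Lemma on_smooth_id v : on_smooth (on_smooth v) = on_smooth v.
Proof. by apply: on_smooth_ext => f sf; rewrite on_smoothE. Qed.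

Lemma chart_vecE a p w f : smooth_fun f ->
  chart_vec a p w f = 'D_w (fun x => f (chart_inv a x) : R^o) (chart_map a p).
Proof. exact: on_smoothE. Qed.

Lemma tangent_chart_vec a p w :
  atlas M a -> chart_dom a p -> tangent p (chart_vec a p w).
Proof. by move=> aa ap; exists a => //; exists w. Qed.

Lemma chart_vec_linear a p : atlas M a -> chart_dom a p -> linear (chart_vec a p).
Proof.
move=> aa ap k w w'; apply/funext => f.
rewrite [RHS]/(k *: chart_vec a p w f + chart_vec a p w' f) /chart_vec /on_smooth.
case: asboolP => [sf|_]; last by rewrite -[RHS]/(k * 0 + 0 : R) mulr0 addr0.
have df := smooth_at_differentiable (smooth_fun_at sf aa ap).
by rewrite !deriveE // linearP.
Qed.

End TangentVectors.

Section Push.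
Context {R : realType} {d e : nat} {M : manifold R d} {N : manifold R e}.

(** The chain rule: the differential of F is its derivative in coordinates. *)
Lemma push_chart_vec (F : M -> N) (a : chart R d M) (b : chart R e N) p w :
  smooth_map F -> atlas M a -> atlas N b -> chart_dom a p -> chart_dom b (F p) ->
  push F (chart_vec a p w) = chart_vec b (F p)
    ('D_w (fun x => chart_map b (F (chart_inv a x))) (chart_map a p)).
Proof.
move=> sF aa bb ap bp; apply: on_smooth_ext => f sf.
have [cF _] := sF; rewrite chart_vecE; last exact: smooth_fun_comp.
rewrite -(near_eq_derive _ (near_pull f cF ap bp)).
have s1 := smooth_map_at sF aa bb ap bp.
have s2 : smooth_at (fun y => f (chart_inv b y) : R^o)
    (chart_map b (F (chart_inv a (chart_map a p)))).
  by rewrite chart_mapK //; apply: smooth_fun_at.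
have D := derive_comp w (smooth_at_differentiable s1) (smooth_at_differentiable s2).
by rewrite D chart_mapK // chart_vecE.
Qed.

Lemma pushE (F : M -> N) v f : smooth_fun f -> push F v f = v (fun p => f (F p)).
Proof. exact: on_smoothE. Qed.

End Push.

Section TangentSpace.
Context {R : realType} {d : nat} {M : manifold R d}.
Implicit Types (f g : M -> R) (p : M) (a b : chart R d M) (u v : vec M).

Lemma smooth_map_id : smooth_map (@id M).
Proof.
split; first by move=> p; apply: cvg_id.
by move=> a b aa bb; apply: atlas_compat.
Qed.

Lemma tangent_on_smooth p v : tangent p v -> on_smooth v = v.
Proof. by move=> [a _ [w ->]]; apply: on_smooth_id. Qed.

(** Pushing forward along the identity changes the chart. *)
Lemma tangentP a p v : atlas M a -> chart_dom a p ->
  tangent p v -> exists w, v = chart_vec a p w.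
Proof.
move=> aa ap [b [bb bp] [w vE]].
have -> : v = push id v by rewrite [RHS](tangent_on_smooth (p := p)) //;
  exists b => //; exists w.
rewrite {1}vE (push_chart_vec w smooth_map_id bb aa bp ap).
by eexists.
Qed.

Lemma tangent_lin p k u v : tangent p u -> tangent p v -> tangent p (k *: u + v).
Proof.
move=> tu tv; have [a aa ap] := atlas_cover p.
have [w ->] := tangentP aa ap tu; have [w' ->] := tangentP aa ap tv.
by rewrite -chart_vec_linear //; apply: tangent_chart_vec.
Qed.

Lemma tangent0 p : tangent p 0.
Proof.
have [a aa ap] := atlas_cover p.
have := chart_vec_linear aa ap (-1) 0 0; rewrite !scaleN1r !addNr => <-.
exact: tangent_chart_vec.
Qed.

Lemma tangentD p u v : tangent p u -> tangent p v -> tangent p (u + v).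
Proof. by rewrite -{2}[u]scale1r; apply: tangent_lin. Qed.

Lemma tangentZ p k u : tangent p u -> tangent p (k *: u).
Proof. by rewrite -[k *: u]addr0 => tu; apply: tangent_lin => //;
  apply: tangent0. Qed.

Lemma tangentN p u : tangent p u -> tangent p (- u).
Proof. by rewrite -scaleN1r; apply: tangentZ. Qed.

Lemma tangentB p u v : tangent p u -> tangent p v -> tangent p (u - v).
Proof. by move=> tu tv; apply: tangentD => //; apply: tangentN. Qed.

Lemma tangent_sum p (I : finType) (c : I -> vec M) :
  (forall i, tangent p (c i)) -> tangent p (\sum_i c i).
Proof.
by move=> tc; apply: (big_ind (tangent p)) => //; [apply: tangent0|apply: tangentD].
Qed.

Lemma tangent_cst p v (c : R) : tangent p v -> v (fun _ => c) = 0.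
Proof.
move=> [a _ [w ->]]; rewrite on_smoothE; last exact: smooth_fun_cst.
exact: derive_cst.
Qed.

Lemma smooth_funB f g : smooth_fun f -> smooth_fun g ->
  smooth_fun (fun q => f q - g q).
Proof.
move=> sf sg; apply: smooth_fun_local => q; have [b bb bq] := atlas_cover q.
exists b; split=> //.
apply: (@eq_smooth_at _ _ _
  (fun x => (f (chart_inv b x) : R^o) + (-1 : R^o) *: (g (chart_inv b x) : R^o))).
  by move=> x; rewrite scaleN1r.
apply: smooth_atD; first exact: smooth_fun_at.
apply: (smooth_atZ (h := fun=> -1) (f := fun x => g (chart_inv b x) : R^o)).
  exact: smooth_at_cst.
exact: smooth_fun_at.
Qed.

Lemma tangent_funB p v f g : tangent p v -> smooth_fun f -> smooth_fun g ->
  v (fun q => f q - g q) = v f - v g.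
Proof.
move=> [a [aa ap] [w ->]] sf sg.
rewrite !on_smoothE //; last exact: smooth_funB.
have df := smooth_at_differentiable (smooth_fun_at sf aa ap).
have dg := smooth_at_differentiable (smooth_fun_at sg aa ap).
exact: (deriveB (diff_derivable df) (diff_derivable dg)).
Qed.

End TangentSpace.

Section SmoothTwoVariables.
Context {R : realType} {c d : nat} {L : manifold R c} {M : manifold R d}.
Implicit Types (K : L -> M -> R) (l : L) (m : M).

Definition smooth_fun2 K := forall a b l m, atlas L a -> atlas M b ->
  chart_dom a l -> chart_dom b m ->
  smooth_at (fun z : 'rV[R]_c * 'rV[R]_d =>
    K (chart_inv a z.1) (chart_inv b z.2) : R^o) (chart_map a l, chart_map b m).

Lemma frame_prod : finite_frame ('rV[R]_c * 'rV[R]_d)%type.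
Proof. by apply: finite_frame_prod; apply: finite_frame_rV. Qed.

Lemma linear_fst (U V : normedModType R) : linear (@fst U V).
Proof. by []. Qed.

Lemma linear_snd (U V : normedModType R) : linear (@snd U V).
Proof. by []. Qed.

Lemma smooth_at_fst (U V : normedModType R) z : smooth_at (@fst U V) z.
Proof. by apply: smooth_at_linear_fun; [exact: linear_fst|move=> y;
  exact: cvg_fst]. Qed.

Lemma smooth_at_snd (U V : normedModType R) z : smooth_at (@snd U V) z.
Proof. by apply: smooth_at_linear_fun; [exact: linear_snd|move=> y;
  exact: cvg_snd]. Qed.

Lemma near_prod (U V : topologicalType) (x : U) (y : V) (P : U -> Prop) (Q :
  V -> Prop) :
  (\forall u \near x, P u) -> (\forall v \near y, Q v) ->
  \forall z \near (x, y), P z.1 /\ Q z.2.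
Proof. by move=> nP nQ; exists (P, Q). Qed.

Lemma near_chart_inv2 (a : chart R c L) (b : chart R d M) l m (P : L * M -> Prop) :
  chart_dom a l -> chart_dom b m -> (\forall q \near (l, m), P q) ->
  \forall z \near (chart_map a l, chart_map b m),
    P (chart_inv a z.1, chart_inv b z.2).
Proof.
move=> al bm [[A B] [/= nA nB] AB].
have nA' := near_chart_inv al nA; have nB' := near_chart_inv bm nB.
by exists ([set x | A (chart_inv a x)], [set x | B (chart_inv b x)]) =>
  // -[x y] /= h; apply: AB.
Qed.

Lemma smooth_map2_at e (N : manifold R e) (F : L -> M -> N)
    (a : chart R c L) (b : chart R d M) (r : chart R e N) l m :
  smooth_map2 F -> atlas L a -> atlas M b -> atlas N r ->
  chart_dom a l -> chart_dom b m -> chart_dom r (F l m) ->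
  smooth_at (fun z : 'rV[R]_c * 'rV[R]_d =>
     chart_map r (F (chart_inv a z.1) (chart_inv b z.2)))
    (chart_map a l, chart_map b m).
Proof.
move=> [cF sF] aa bb rr al bm rF; apply: smooth_on_at (sF a b r aa bb rr) _;
  last first.
  by split; rewrite /= ?chart_mapK //; apply: chart_img_map.
rewrite openE => -[x y] /= [[l' al' <-] [m' bm' <-]]; rewrite !chart_mapK // => rF'.
have n1 : \forall z \near (chart_map a l', chart_map b m'),
    chart_img a z.1 /\ chart_img b z.2.
  by apply: near_prod; apply: near_chart_img.
have n2 : \forall z \near (l', m'), chart_dom r (F z.1 z.2).
  exact: (cF (l', m') _ (near_chart_dom rF')).
have n3 := near_chart_inv2 al' bm' n2.
by apply: filterS2 n1 n3 => z [].
Qed.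

Lemma smooth_fun2_comp e (N : manifold R e) (F : L -> M -> N) (f : N -> R) :
  smooth_map2 F -> smooth_fun f -> smooth_fun2 (fun l m => f (F l m)).
Proof.
move=> sF sf a b l m aa bb al bm.
have [r rr rF] := atlas_cover (F l m).
have n2 : \forall z \near (l, m), chart_dom r (F z.1 z.2).
  exact: (sF.1 (l, m) _ (near_chart_dom rF)).
have n3 := near_chart_inv2 al bm n2.
apply: (@near_eq_smooth_at _ _ _ (fun z : 'rV[R]_c * 'rV[R]_d =>
  (fun y => f (chart_inv r y) : R^o)
  (chart_map r (F (chart_inv a z.1) (chart_inv b z.2))))).
  by apply: filterS n3 => z rz; rewrite /= chart_mapK.
apply: (smooth_at_comp (g := fun y => f (chart_inv r y) : R^o)).
- exact: finite_frame_rV.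
- exact: smooth_map2_at.
- by rewrite !chart_mapK //; apply: smooth_fun_at.
Qed.

End SmoothTwoVariables.

(** * Partial derivatives and functions of two variables *)

Section PartialDerivatives.
Context {R : realType} {U V : normedModType R}.

Lemma derive_slice1 (W : normedModType R) (f : U * V -> W) (x : U) (y : V) (u : U) :
  differentiable f (x, y) -> 'D_u (fun x' => f (x', y)) x = 'D_(u, 0) f (x, y).
Proof.
move=> df; have di : is_diff x (fun x' : U => (x', y)) (fun u => (u, 0)).
  by apply: is_diff_pair.
have dd := @ex_diff _ _ _ _ _ _ _ di.
rewrite (derive_comp (f := fun x' : U => (x', y)) u dd df); congr ('D_ _ f _).
by rewrite deriveE // diff_val.
Qed.

Lemma derive_slice2 (W : normedModType R) (f : U * V -> W) (x : U) (y : V) (v : V) :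
  differentiable f (x, y) -> 'D_v (fun y' => f (x, y')) y = 'D_(0, v) f (x, y).
Proof.
move=> df; have di : is_diff y (fun y' : V => (x, y')) (fun v => (0, v)).
  by apply: is_diff_pair.
have dd := @ex_diff _ _ _ _ _ _ _ di.
rewrite (derive_comp (f := fun y' : V => (x, y')) v dd df); congr ('D_ _ f _).
by rewrite deriveE // diff_val.
Qed.

Hypotheses (fU : finite_frame U) (fV : finite_frame V).

Lemma smooth_at_slice1 (W : normedModType R) (f : U * V -> W) x y :
  smooth_at f (x, y) -> smooth_at (fun x' => f (x', y)) x.
Proof.
move=> sf; apply: (smooth_at_comp (f := fun x' : U => (x', y)) (g := f)) => //.
  exact: finite_frame_prod.
apply: (smooth_at_pair (f := fun x' : U => x') (g := fun _ : U => y)) => //.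
  by apply: smooth_at_linear_fun => // z; apply: cvg_id.
exact: smooth_at_cst.
Qed.

Lemma smooth_at_slice2 (W : normedModType R) (f : U * V -> W) x y :
  smooth_at f (x, y) -> smooth_at (fun y' => f (x, y')) y.
Proof.
move=> sf; apply: (smooth_at_comp (f := fun y' : V => (x, y')) (g := f)) => //.
  exact: finite_frame_prod.
apply: (smooth_at_pair (f := fun _ : V => x) (g := fun y' : V => y')) => //.
  exact: smooth_at_cst.
by apply: smooth_at_linear_fun => // z; apply: cvg_id.
Qed.

Lemma near_slice1 (P : U * V -> Prop) (x : U) (y : V) :
  (\forall z \near (x, y), P z) -> \forall x' \near x, P (x', y).
Proof.
move=> [[A B] [/= nA nB] AB]; apply: filterS nA => x' Ax'; apply: AB.
by split=> //=; apply: nbhs_singleton.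
Qed.

Lemma near_slice2 (P : U * V -> Prop) (x : U) (y : V) :
  (\forall z \near (x, y), P z) -> \forall y' \near y, P (x, y').
Proof.
move=> [[A B] [/= nA nB] AB]; apply: filterS nB => y' By'; apply: AB.
by split=> //=; apply: nbhs_singleton.
Qed.

Lemma near_derive_slice1 (W : normedModType R) (f : U * V -> W) x y (u : U) :
  smooth_at f (x, y) ->
  \forall y' \near y, 'D_(u, 0) f (x, y') = 'D_u (fun x' => f (x', y')) x.
Proof.
move=> /smooth_at_near /near_slice2; apply: filterS => y' /smooth_at_differentiable.
by move=> df; rewrite derive_slice1.
Qed.

Lemma near_derive_slice2 (W : normedModType R) (f : U * V -> W) x y (v : V) :
  smooth_at f (x, y) ->
  \forall x' \near x, 'D_(0, v) f (x', y) = 'D_v (fun y' => f (x', y')) y.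
Proof.
move=> /smooth_at_near /near_slice1; apply: filterS => x' /smooth_at_differentiable.
by move=> df; rewrite derive_slice2.
Qed.

Lemma smooth_at_partial1 (W : normedModType R) (f : U * V -> W) x y (u : U) :
  smooth_at f (x, y) -> smooth_at (fun y' => 'D_u (fun x' => f (x', y')) x) y.
Proof.
move=> sf; apply: near_eq_smooth_at (near_derive_slice1 u sf) _.
exact: (smooth_at_slice2 (smooth_at_derive (u, 0) sf)).
Qed.

Lemma smooth_at_partial2 (W : normedModType R) (f : U * V -> W) x y (v : V) :
  smooth_at f (x, y) -> smooth_at (fun x' => 'D_v (fun y' => f (x', y')) y) x.
Proof.
move=> sf; apply: near_eq_smooth_at (near_derive_slice2 v sf) _.
exact: (smooth_at_slice1 (smooth_at_derive (0, v) sf)).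
Qed.

Lemma partial_comm (f : U * V -> R^o) x y (u : U) (v : V) :
  smooth_at f (x, y) ->
  'D_u (fun x' => 'D_v (fun y' => f (x', y')) y) x =
  'D_v (fun y' => 'D_u (fun x' => f (x', y')) x) y.
Proof.
move=> sf.
rewrite -(near_eq_derive u (near_derive_slice2 v sf)).
rewrite -(near_eq_derive v (near_derive_slice1 u sf)).
rewrite (derive_slice1 u (smooth_at_differentiable (smooth_at_derive (0, v) sf))).
rewrite (derive_slice2 v (smooth_at_differentiable (smooth_at_derive (u, 0) sf))).
exact: derive_comm.
Qed.

End PartialDerivatives.

Section TwoVariables.
Context {R : realType} {c d : nat} {L : manifold R c} {M : manifold R d}.
Implicit Types (K : L -> M -> R) (l : L) (m : M).

Lemma smooth_fun2_slice1 K m : smooth_fun2 K -> smooth_fun (fun l => K l m).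
Proof.
move=> sK; apply: smooth_fun_local => l.
have [a aa al] := atlas_cover l; have [b bb bm] := atlas_cover m.
exists a; split=> //; have := sK a b l m aa bb al bm.
move=> /(smooth_at_slice1 (finite_frame_rV c) (finite_frame_rV d)).
by apply: eq_smooth_at => x; rewrite /= chart_mapK.
Qed.

Lemma smooth_fun2_slice2 K l : smooth_fun2 K -> smooth_fun (K l).
Proof.
move=> sK; apply: smooth_fun_local => m.
have [a aa al] := atlas_cover l; have [b bb bm] := atlas_cover m.
exists b; split=> //; have := sK a b l m aa bb al bm.
move=> /(smooth_at_slice2 (finite_frame_rV c) (finite_frame_rV d)).
by apply: eq_smooth_at => x; rewrite /= chart_mapK.
Qed.

Lemma smooth_fun2_vec1 K l (u : vec L) : smooth_fun2 K -> tangent l u ->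
  smooth_fun (fun m => u (fun l' => K l' m)).
Proof.
move=> sK [a [aa al] [w ->]]; apply: smooth_fun_local => m.
have [b bb bm] := atlas_cover m; exists b; split=> //.
have := sK a b l m aa bb al bm.
move=> /(smooth_at_partial1 (finite_frame_rV c) (finite_frame_rV d) w).
apply: eq_smooth_at => y /=; rewrite on_smoothE //.
exact: (smooth_fun2_slice1 _ sK).
Qed.

Lemma smooth_fun2_vec2 K m (v : vec M) : smooth_fun2 K -> tangent m v ->
  smooth_fun (fun l => v (K l)).
Proof.
move=> sK [b [bb bm] [w ->]]; apply: smooth_fun_local => l.
have [a aa al] := atlas_cover l; exists a; split=> //.
have := sK a b l m aa bb al bm.
move=> /(smooth_at_partial2 (finite_frame_rV c) (finite_frame_rV d) w).
apply: eq_smooth_at => y /=; rewrite on_smoothE //.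
exact: (smooth_fun2_slice2 _ sK).
Qed.

(** The symmetry of second derivatives: derivations acting on separate variables
    commute. The brackets of left-invariant and of fundamental fields are
    computed from it. *)
Lemma tangent_comm K l m (u : vec L) (v : vec M) : smooth_fun2 K ->
  tangent l u -> tangent m v ->
  u (fun l' => v (K l')) = v (fun m' => u (fun l' => K l' m')).
Proof.
move=> sK tu tv.
have s1 := smooth_fun2_vec2 sK tv; have s2 := smooth_fun2_vec1 sK tu.
have [a [aa al] [w uE]] := tu; have [b [bb bm] [w' vE]] := tv.
rewrite {1}uE {2}vE !on_smoothE // {}vE {}uE.
have E1 (x : 'rV[R]_c) : on_smooth (fun f : M -> R =>
     'D_w' (fun y => f (chart_inv b y) : R^o) (chart_map b m)) (K (chart_inv a x)) =
     'D_w' (fun y => K (chart_inv a x) (chart_inv b y) : R^o) (chart_map b m).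
  by rewrite on_smoothE //; apply: smooth_fun2_slice2.
have E2 (y : 'rV[R]_d) : on_smooth (fun f : L -> R =>
     'D_w (fun x => f (chart_inv a x) : R^o) (chart_map a l))
       (fun l' => K l' (chart_inv b y)) =
     'D_w (fun x => K (chart_inv a x) (chart_inv b y) : R^o) (chart_map a l).
  by rewrite on_smoothE //; apply: smooth_fun2_slice1.
under eq_fun do rewrite E1.
under [in RHS]eq_fun do rewrite E2.
exact: (partial_comm w w' (sK a b l m aa bb al bm)).

Qed.

Lemma smooth_map2_slice1 e (N : manifold R e) (F : L -> M -> N) m :
  smooth_map2 F -> smooth_map (fun l => F l m).
Proof.
move=> sF; split.
  move=> l; have cp : {for l, continuous (fun l' : L => (l', m))}.
    by apply: cvg_pair; [exact: cvg_id|exact: cvg_cst].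
  exact: (continuous_comp cp (sF.1 (l, m))).
move=> a r aa rr; apply: smooth_at_on => _ [[l al <-]]; rewrite chart_mapK // => rF.
have [b bb bm] := atlas_cover m.
have := smooth_map2_at sF aa bb rr al bm rF.
move=> /(smooth_at_slice1 (finite_frame_rV c) (finite_frame_rV d)).
by apply: eq_smooth_at => x; rewrite /= chart_mapK.
Qed.

Lemma smooth_map2_slice2 e (N : manifold R e) (F : L -> M -> N) l :
  smooth_map2 F -> smooth_map (F l).
Proof.
move=> sF; split.
  move=> m; have cp : {for m, continuous (fun m' : M => (l, m'))}.
    by apply: cvg_pair; [exact: cvg_cst|exact: cvg_id].
  exact: (continuous_comp cp (sF.1 (l, m))).
move=> b r bb rr; apply: smooth_at_on => _ [[m bm <-]]; rewrite chart_mapK // => rF.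
have [a aa al] := atlas_cover l.
have := smooth_map2_at sF aa bb rr al bm rF.
move=> /(smooth_at_slice2 (finite_frame_rV c) (finite_frame_rV d)).
by apply: eq_smooth_at => x; rewrite /= chart_mapK.
Qed.

End TwoVariables.

Section SmoothMap2Comp.
Context {R : realType} {c d : nat} {L : manifold R c} {M : manifold R d}.

Lemma smooth_map2_local e (N : manifold R e) (F : L -> M -> N) :
  continuous (fun z : L * M => F z.1 z.2) ->
  (forall a b r l m, atlas L a -> atlas M b -> atlas N r ->
    chart_dom a l -> chart_dom b m -> chart_dom r (F l m) ->
    smooth_at (fun z : 'rV[R]_c * 'rV[R]_d =>
       chart_map r (F (chart_inv a z.1) (chart_inv b z.2)))
      (chart_map a l, chart_map b m)) -> smooth_map2 F.
Proof.
move=> cF sF; split=> // a b r aa bb rr; apply: smooth_at_on => -[x y] /=.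
by move=> [[l al <-] [m bm <-]]; rewrite !chart_mapK // => rF; apply: sF.
Qed.

Lemma smooth_map2_fst : smooth_map2 (fun (l : L) (m : M) => l).
Proof.
apply: smooth_map2_local; first by move=> z; apply: cvg_fst.
move=> a b r l m aa bb rr al bm rl.
apply: (smooth_at_comp (f := fst) (g := fun x => chart_map r (chart_inv a x))).
- exact: finite_frame_rV.
- exact: smooth_at_fst.
- exact: chart_change_smooth.
Qed.

Lemma smooth_map2_snd : smooth_map2 (fun (l : L) (m : M) => m).
Proof.
apply: smooth_map2_local; first by move=> z; apply: cvg_snd.
move=> a b r l m aa bb rr al bm rl.
apply: (smooth_at_comp (f := snd) (g := fun x => chart_map r (chart_inv b x))).
- exact: finite_frame_rV.
- exact: smooth_at_snd.
- exact: chart_change_smooth.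
Qed.

Lemma smooth_map2_comp p q e (P : manifold R p) (Q : manifold R q)
    (N : manifold R e) (B : P -> Q -> N) (F : L -> M -> P) (E : L -> M -> Q) :
  smooth_map2 B -> smooth_map2 F -> smooth_map2 E ->
  smooth_map2 (fun l m => B (F l m) (E l m)).
Proof.
move=> sB sF sE; apply: smooth_map2_local.
  move=> z; apply: (@continuous_comp _ _ _ (fun z : L * M => (F z.1 z.2, E z.1 z.2))
    (fun z => B z.1 z.2)); last exact: sB.1.
  by apply: cvg_pair; [apply: sF.1|apply: sE.1].
move=> a b r l m aa bb rr al bm rB.
have [f ff fF] := atlas_cover (F l m); have [g gg gE] := atlas_cover (E l m).
have nF : \forall z \near (l, m), chart_dom f (F z.1 z.2).
  exact: (sF.1 (l, m) _ (near_chart_dom fF)).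
have nE : \forall z \near (l, m), chart_dom g (E z.1 z.2).
  exact: (sE.1 (l, m) _ (near_chart_dom gE)).
have nF' := near_chart_inv2 al bm nF; have nE' := near_chart_inv2 al bm nE.
apply: (@near_eq_smooth_at _ _ _ (fun z : 'rV[R]_c * 'rV[R]_d =>
  (fun y => chart_map r (B (chart_inv f y.1) (chart_inv g y.2)))
  (chart_map f (F (chart_inv a z.1) (chart_inv b z.2)),
   chart_map g (E (chart_inv a z.1) (chart_inv b z.2))))).
  by apply: filterS2 nF' nE' => z fz gz; rewrite /= !chart_mapK.
apply: (smooth_at_comp (g := fun y =>
  chart_map r (B (chart_inv f y.1) (chart_inv g y.2)))).
- by apply: finite_frame_prod; apply: finite_frame_rV.
- apply: smooth_at_pair; try exact: finite_frame_rV; exact: smooth_map2_at.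
- by rewrite !chart_mapK //; apply: smooth_map2_at.
Qed.

Lemma smooth_map2_comp1 p q (P : manifold R p) (N : manifold R q) (B : P -> N)
    (F : L -> M -> P) :
  smooth_map B -> smooth_map2 F -> smooth_map2 (fun l m => B (F l m)).
Proof.
move=> sB sF; apply: smooth_map2_local.
  move=> z; apply: (@continuous_comp _ _ _ (fun z : L * M => F z.1 z.2) B).
    exact: sF.1.
  exact: sB.1.
move=> a b r l m aa bb rr al bm rB.
have [f ff fF] := atlas_cover (F l m).
have nF : \forall z \near (l, m), chart_dom f (F z.1 z.2).
  exact: (sF.1 (l, m) _ (near_chart_dom fF)).
have nF' := near_chart_inv2 al bm nF.
apply: (@near_eq_smooth_at _ _ _ (fun z : 'rV[R]_c * 'rV[R]_d =>
  (fun y => chart_map r (B (chart_inv f y)))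
  (chart_map f (F (chart_inv a z.1) (chart_inv b z.2))))).
  by apply: filterS nF' => z fz; rewrite /= !chart_mapK.
apply: (smooth_at_comp (g := fun y => chart_map r (B (chart_inv f y)))).
- exact: finite_frame_rV.
- exact: smooth_map2_at.
- by rewrite !chart_mapK //; apply: smooth_map_at.
Qed.

End SmoothMap2Comp.

Section PushTangent.
Context {R : realType} {d e k : nat} {M : manifold R d} {N : manifold R e}.
Context {P : manifold R k}.

Lemma push_tangent (F : M -> N) p v :
  smooth_map F -> tangent p v -> tangent (F p) (push F v).
Proof.
move=> sF [a [aa ap] [w ->]]; have [b bb bp] := atlas_cover (F p).
by rewrite (push_chart_vec w sF aa bb ap bp); apply: tangent_chart_vec.
Qed.

Lemma push_push (F : M -> N) (E : N -> P) v :
  smooth_map E -> push E (push F v) = push (fun p => E (F p)) v.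
Proof.
move=> sE; apply: on_smooth_ext => f sf; rewrite pushE //.
exact: smooth_fun_comp.
Qed.

Lemma push_lin (F : M -> N) t u v : push F (t *: u + v) = t *: push F u + push F v.
Proof.
apply/funext => f; rewrite [RHS]/(t *: push F u f + push F v f) /push /on_smooth.
by case: asboolP => // _; rewrite -[RHS]/(t * 0 + 0 : R) mulr0 addr0.
Qed.

End PushTangent.

(** * The adjoint curve of a Lie group *)

Lemma linear_sumZ (R : nzRingType) (U V : lmodType R) (f : U -> V) (I : finType)
    (k : I -> R) (v : I -> U) :
  linear f -> f (\sum_i k i *: v i) = \sum_i k i *: f (v i).
Proof.
move=> lf; elim: (index_enum I) => [|i s IH]; last by rewrite !big_cons lf IH.
by rewrite !big_nil; have := lf (-1) 0 0; rewrite !scaleN1r !addNr.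
Qed.

Lemma vec_sumE (R : realType) n (M : manifold R n) (I : finType)
    (k : I -> R) (v : I -> vec M) f :
  (\sum_i k i *: v i) f = \sum_i k i * v i f.
Proof.
elim: (index_enum I) => [|i s IH]; first by rewrite !big_nil.
by rewrite !big_cons -IH.
Qed.

Lemma is_derive_sum_fun (R : realType) (V : normedModType R) (I : finType)
    (f : I -> V -> R^o) (df : I -> R^o) (z x : V) :
  (forall i, is_derive z x (f i) (df i)) ->
  is_derive z x (fun y => \sum_i f i y : R^o) (\sum_i df i).
Proof.
move=> H; elim: (index_enum I) => [|i s IH].
  have -> : (fun y => \sum_(i <- [::]) f i y) = cst 0.
    by apply/funext => y; rewrite big_nil.
  by rewrite big_nil; apply: is_derive_cst.
have -> : (fun y => \sum_(j <- i :: s) f j y) = f i + (fun y =>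
  \sum_(j <- s) f j y).
  by apply/funext => y; rewrite big_cons.
by rewrite big_cons; apply: is_deriveD.
Qed.

Lemma is_derive_mul (R : realType) (V : normedModType R)
    (f g : V -> R^o) (z x : V) :
  differentiable f z -> differentiable g z ->
  is_derive z x (fun y => f y * g y : R^o) (f z * 'D_x g z + 'D_x f z * g z : R).
Proof.
move=> df dg; apply: DeriveDef; last exact: derive_scale.
by apply: diff_derivable; apply: differentiable_scale.
Qed.

Section LieGroups.
Context {R : realType} {d : nat} {G : lieGroup R d}.
Implicit Types (a b : G) (X Y : vec G).
Local Notation e := (lg_one G).
Local Notation mul := (@lg_mul R d G).
Local Notation inv := (@lg_inv R d G).

Lemma lg_mulgV a : mul a (inv a) = e.
Proof.
rewrite -[LHS](lg_mul1 (l := G)) -{1}(lg_mulV (l := G) (inv a)) -lg_mulA.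
by rewrite (lg_mulA (inv a)) lg_mulV lg_mul1 lg_mulV.
Qed.

Lemma lg_mulg1 a : mul a e = a.
Proof. by rewrite -(lg_mulV (l := G) a) lg_mulA lg_mulgV lg_mul1. Qed.

Lemma lg_invK a : inv (inv a) = a.
Proof.
by rewrite -[LHS]lg_mulg1 -(lg_mulV (l := G) a) lg_mulA lg_mulV lg_mul1.
Qed.

Lemma lg_inv1 : inv e = e.
Proof. by rewrite -[LHS]lg_mulg1 lg_mulV. Qed.

Lemma smooth_map2_conj : smooth_map2 (fun a b => mul (mul (inv a) b) (inv (inv a))).
Proof.
apply: smooth_map2_comp; first exact: lg_mul_smooth.
  apply: smooth_map2_comp; first exact: lg_mul_smooth.
    by apply: (smooth_map2_comp1 (F := fun a _ => a));
      [exact: lg_inv_smooth|exact: smooth_map2_fst].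
  exact: smooth_map2_snd.
by apply: (smooth_map2_comp1 (F := fun a _ => inv a)); [exact: lg_inv_smooth|
   apply: (smooth_map2_comp1 (F := fun a _ => a));
     [exact: lg_inv_smooth|exact: smooth_map2_fst]].
Qed.

Lemma smooth_fun2_mul (F : G -> R) :
  smooth_fun F -> smooth_fun2 (fun a b => F (mul a b)).
Proof. by move=> sF; apply: smooth_fun2_comp => //; apply: lg_mul_smooth. Qed.

Lemma smooth_fun2_swap c k (L : manifold R c) (M : manifold R k) (K : L -> M -> R) :
  smooth_fun2 K -> smooth_fun2 (fun m l => K l m).
Proof.
move=> sK b a m l bb aa bm al.
have := sK a b l m aa bb al bm => sKab.
have sw : smooth_at (fun z : 'rV[R]_k * 'rV[R]_c =>
  (z.2, z.1)) (chart_map b m, chart_map a l).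
  apply: smooth_at_pair; try exact: finite_frame_rV.
    exact: smooth_at_snd.
  exact: smooth_at_fst.
exact: (smooth_at_comp (@frame_prod _ _ _) sw sKab).
Qed.

Lemma left_invariantE X a F : smooth_fun F ->
  left_invariant X a F = X (fun b => F (mul a b)).
Proof. exact: pushE. Qed.

Lemma bracketE X Y F : tangent e X -> tangent e Y -> smooth_fun F ->
  bracket X Y F = X (fun a => Y (fun b => F (mul a b))) -
                  Y (fun a => X (fun b => F (mul a b))).
Proof.
move=> tX tY sF; rewrite /bracket /lie on_smoothE //.
have H (Z W : vec G) : tangent e W ->
    left_invariant Z e (fun q => left_invariant W q F) =
    Z (fun a => W (fun b => F (mul a b))).
  move=> tW; under eq_fun do rewrite left_invariantE //.
  rewrite left_invariantE; last exact: (smooth_fun2_vec2 (smooth_fun2_mul sF) tW).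
  by under [in RHS]eq_fun => a do rewrite -{1}(lg_mul1 (l := G) a).
by rewrite !H.
Qed.

Lemma Ad1 Y : tangent e Y -> Ad (inv e) Y = Y.
Proof.
move=> tY; rewrite /Ad !lg_inv1 -[RHS](tangent_on_smooth tY).
apply: on_smooth_ext => f sf; congr Y; apply/funext => b.
by rewrite lg_mul1 lg_mulg1.
Qed.

(** All conjugations fix the unit, so Ad (a^-1) Y is a curve in one tangent
    space, with coordinates w. Since a (a^-1 b a) = b a,
      Y_b F(b a) = sum_i w_i(a) (E_i)_b F(a b)
    for every smooth F. Differentiating at the unit along X and exchanging the
    derivations X_a and Y_b identifies the derivative of w with - [X, Y]. *)
Lemma Ad_derivative (c : chart R d G) x Y : atlas G c -> chart_dom c e ->
  tangent e Y ->
  exists (E : 'I_d -> vec G) (w : 'I_d -> G -> R^o),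
  [/\ forall i, tangent e (E i),
      forall a, Ad (inv a) Y = \sum_i w i a *: E i,
      forall i, smooth_at (fun z => w i (chart_inv c z)) (chart_map c e) &
      bracket (chart_vec c e x) Y = - \sum_i
        ('D_x (fun z => w i (chart_inv c z)) (chart_map c e) : R) *: E i].
Proof.
move=> cc ce tY; have [y YE] := tangentP cc ce tY.
pose C a b := mul (mul (inv a) b) (inv (inv a)).
have sC : smooth_map2 C := smooth_map2_conj.
have Ce a : C a e = e by rewrite /C lg_mulg1 lg_mulgV.
pose W a := 'D_y (fun z => chart_map c (C a (chart_inv c z))) (chart_map c e).
pose E (i : 'I_d) := chart_vec c e (delta_mx 0 i).
have tE i : tangent e (E i) by apply: tangent_chart_vec.
have chart_vec_sum (v : 'rV[R]_d) : chart_vec c e v = \sum_i v 0 i *: E i.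
  by rewrite {1}(row_sum_delta v) (linear_sumZ _ _ (chart_vec_linear cc ce)).
have AdE a : Ad (inv a) Y = \sum_i W a 0 i *: E i.
  rewrite -chart_vec_sum YE /Ad.
  have sCa := smooth_map2_slice2 a sC.
  have ceC : chart_dom c (C a e) by rewrite Ce.
  by have := push_chart_vec y sCa cc cc ce ceC; rewrite Ce.
have sW : smooth_at (fun z => W (chart_inv c z)) (chart_map c e).
  have ceC : chart_dom c (C e e) by rewrite Ce.
  have := smooth_map2_at sC cc cc cc ce ce ceC.
  exact: (smooth_at_partial2 (finite_frame_rV d) (finite_frame_rV d)).
have sWi i : smooth_at (fun z => W (chart_inv c z) 0 i : R^o) (chart_map c e).
  apply: (smooth_at_comp (g := fun v : 'rV[R]_d => v 0 i :
    R^o) (finite_frame_rV d) sW).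
  by apply: smooth_at_linear_fun; [move=> k u v;
    rewrite !mxE|apply: coord_continuous].
exists E, (fun i a => W a 0 i); split=> //.
set X := chart_vec c e x.
have tX : tangent e X by apply: tangent_chart_vec.
pose D i := 'D_x (fun z => W (chart_inv c z) 0 i : R^o) (chart_map c e).
have tDE : tangent e (- \sum_i (D i : R) *: E i).
  by apply: tangentN; apply: tangent_sum => i; apply: tangentZ.
have -> : bracket X Y = on_smooth (bracket X Y)
  by rewrite /bracket /lie on_smooth_id.
rewrite -(tangent_on_smooth tDE); apply: on_smooth_ext => F sF.
rewrite bracketE // -[RHS]/(- ((\sum_i (D i : R) *: E i) F)) vec_sumE.
have sK := smooth_fun2_mul sF.
have E1 : X (fun a => Y (fun b => F (mul a b))) =
    \sum_i W e 0 i * X (fun a => E i (fun b => F (mul a b))).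
  rewrite (tangent_comm sK tX tY).
  have YW : Y = \sum_i W e 0 i *: E i.
    by rewrite -AdE Ad1.
  rewrite {1}YW vec_sumE; apply: eq_bigr => i _.
  by rewrite (tangent_comm sK tX (tE i)).
have sK' := smooth_fun2_swap sK.
have E2 : (fun a => Y (fun b => F (mul b a))) =
    fun a => \sum_i W a 0 i * E i (fun b => F (mul a b)).
  apply/funext => a.
  rewrite -vec_sumE -AdE /Ad pushE; last exact: smooth_fun2_slice2 sK.
  by congr Y; apply/funext => b; rewrite lg_invK !lg_mulA lg_mulgV lg_mul1.
rewrite [in X in _ - X](tangent_comm sK tY tX) E1.
have sY : smooth_fun (fun a => Y (fun b => F (mul b a))).
  exact: (smooth_fun2_vec2 sK' tY).
have sE i : smooth_fun (fun a => E i (fun b => F (mul a b))).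
  exact: (smooth_fun2_vec2 sK (tE i)).
move: sY; rewrite E2 => sY; rewrite {2}/X chart_vecE //.
have dd := is_derive_sum_fun (fun i => is_derive_mul x
  (smooth_at_differentiable (sWi i))
    (smooth_at_differentiable (smooth_fun_at (sE i) cc ce))).
rewrite (@derive_val _ _ _ _ _ _ _ dd) chart_mapK // big_split /= opprD addrA.
under eq_bigr => i _ do rewrite {1}/X chart_vecE //.
rewrite subrr add0r; congr (- _); apply: eq_bigr => i _; congr (_ * _).
by congr (E i); apply/funext => b; rewrite lg_mul1.
Qed.

End LieGroups.

(** * Fundamental fields, invariant tensors and the Koszul formula *)

Section LinearOnTangent.
Context {R : realType} {d : nat} {M : manifold R d}.

(** Tensors are constrained on tangent vectors only, so linearity is relative to
    the tangent space. *)
Definition linear_at (p : M) (l : vec M -> R) :=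
  forall (k : R) u v, tangent p u -> tangent p v -> l (k *: u + v) = k * l u + l v.

Lemma linear_at0 p l : linear_at p l -> l 0 = 0.
Proof.
move=> ll; have t0 := tangent0 p; have := ll (-1) 0 0 t0 t0.
by rewrite scaleN1r addNr mulN1r addNr.
Qed.

Lemma linear_atD p l u v : linear_at p l -> tangent p u -> tangent p v ->
  l (u + v) = l u + l v.
Proof. by move=> ll tu tv; rewrite -[u in LHS]scale1r ll // mul1r. Qed.

Lemma linear_atZ p l k u : linear_at p l -> tangent p u -> l (k *: u) = k * l u.
Proof.
by move=> ll tu; rewrite -[_ *: _]addr0 ll ?(linear_at0 ll) ?addr0 //;
  apply: tangent0.
Qed.

Lemma linear_atN p l u : linear_at p l -> tangent p u -> l (- u) = - l u.
Proof. by move=> ll tu; rewrite -scaleN1r (linear_atZ _ ll) // mulN1r. Qed.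

Lemma linear_atB p l u v : linear_at p l -> tangent p u -> tangent p v ->
  l (u - v) = l u - l v.
Proof.
by move=> ll tu tv; rewrite (linear_atD ll) ?(linear_atN ll) //; apply: tangentN.
Qed.

Lemma linear_at_sum p l (I : finType) (k : I -> R) (v : I -> vec M) :
  linear_at p l -> (forall i, tangent p (v i)) ->
  l (\sum_i k i *: v i) = \sum_i k i * l (v i).
Proof.
move=> ll tv; pose P (u : vec M) (x : R) := tangent p u /\ l u = x.
suff [] : P (\sum_i k i *: v i) (\sum_i k i * l (v i)) by [].
apply: (big_rec2 P); first by split; [exact: tangent0|exact: linear_at0 ll].
move=> i x u _ [tu <-]; split; first by apply: tangent_lin.
by rewrite ll.
Qed.

End LinearOnTangent.

Section AdInvariance.
Context {R : realType} {d : nat} {G : lieGroup R d}.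
Implicit Types (X Y Z : vec G).
Local Notation e := (lg_one G).

(** The bracket is, up to sign, the derivative of a curve in the tangent space
    at the unit. *)
Lemma bracket_tangent X Y : tangent e X -> tangent e Y -> tangent e (bracket X Y).
Proof.
move=> tX tY; have [c cc ce] := atlas_cover e; have [x ->] := tangentP cc ce tX.
have [E [w [tE _ _ ->]]] := Ad_derivative x cc ce tY.
by apply: tangentN; apply: tangent_sum => i; apply: tangentZ.
Qed.

Lemma bracketC X Y : bracket Y X = - bracket X Y.
Proof.
apply/funext => f; rewrite -[RHS]/(- (bracket X Y f)) /bracket /lie /on_smooth.
by case: asboolP => _; rewrite ?opprB ?oppr0.
Qed.

Lemma Ad_tangent a Y : tangent e Y -> tangent e (Ad (lg_inv a) Y).
Proof.
move=> tY; have := push_tangent (smooth_map2_slice2 a smooth_map2_conj) tY.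
by rewrite lg_mulg1 lg_mulgV.
Qed.

(** h is a linear function of the curve Ad (a^-1) Y, whose derivative along X is
    - [X, Y]. *)
Lemma Ad_invariant1 (l : vec G -> R) (h : G -> R) X Y :
  linear_at e l -> tangent e X -> tangent e Y -> smooth_fun h ->
  (forall a, h a = l (Ad (lg_inv a) Y)) -> X h = - l (bracket X Y).
Proof.
move=> ll tX tY sh hE; have [c cc ce] := atlas_cover e.
have [x XE] := tangentP cc ce tX.
have [E [w [tE AdE sw]]] := Ad_derivative x cc ce tY; rewrite -XE => ->.
rewrite (linear_atN ll); last by apply: tangent_sum => i; apply: tangentZ.
rewrite opprK (linear_at_sum _ ll tE) XE chart_vecE //.
have -> : h = fun a => \sum_i w i a * l (E i).
  by apply/funext => a; rewrite hE AdE (linear_at_sum _ ll tE).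
have dd := is_derive_sum_fun (fun i => is_derive_mul x
  (smooth_at_differentiable (sw i)) (differentiable_cst (l (E i) :
    R^o) (chart_map c e))).
rewrite (@derive_val _ _ _ _ _ _ _ dd); apply: eq_bigr => i _.
by rewrite derive_cst mulr0 add0r.
Qed.

(** The Leibniz rule for the curves Ad (a^-1) Y and Ad (a^-1) Z. *)
Lemma Ad_invariant2 (B : vec G -> vec G -> R) (h : G -> R) X Y Z :
  (forall v, tangent e v -> linear_at e (B^~ v)) ->
  (forall u, tangent e u -> linear_at e (B u)) ->
  tangent e X -> tangent e Y -> tangent e Z -> smooth_fun h ->
  (forall a, h a = B (Ad (lg_inv a) Y) (Ad (lg_inv a) Z)) ->
  X h = - B (bracket X Y) Z - B Y (bracket X Z).
Proof.
move=> Bl Br tX tY tZ sh hE; have [c cc ce] := atlas_cover e.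
have [x XE] := tangentP cc ce tX.
have [E [w [tE AdE sw]]] := Ad_derivative x cc ce tY; rewrite -XE => bE.
have [F [z [tF AdF sz]]] := Ad_derivative x cc ce tZ; rewrite -XE => bF.
have BE (k l : 'I_d -> R) : B (\sum_i k i *: E i) (\sum_j l j *: F j) =
    \sum_(p : 'I_d * 'I_d) (k p.1 * l p.2) * B (E p.1) (F p.2).
  have tlF : tangent e (\sum_j l j *: F j) by apply: tangent_sum => i;
    apply: tangentZ.
  rewrite (linear_at_sum _ (Bl _ tlF) tE) -(pair_bigA _ (fun i j =>
    k i * l j * B (E i) (F j))) /=.
  apply: eq_bigr => i _; rewrite (linear_at_sum _ (Br _ (tE i)) tF) mulr_sumr.
  by apply: eq_bigr => j _; rewrite mulrA.
have tDE k : tangent e (\sum_i k i *: E i) by apply: tangent_sum => i;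
  apply: tangentZ.
have tDF k : tangent e (\sum_i k i *: F i) by apply: tangent_sum => i;
  apply: tangentZ.
rewrite bE bF (linear_atN (Bl _ tZ)) // (linear_atN (Br _ tY)) // !opprK.
rewrite -{1}(Ad1 tZ) -{1}(Ad1 tY) AdE AdF !BE -big_split /=.
have hf : h = fun a => \sum_(p :
  'I_d * 'I_d) (w p.1 a * z p.2 a) * B (E p.1) (F p.2).
  by apply/funext => a; rewrite hE AdE AdF BE.
move: sh; rewrite hf XE => sh; rewrite chart_vecE //.
have dw i := smooth_at_differentiable (sw i).
have dz i := smooth_at_differentiable (sz i).
have dd := is_derive_sum_fun (fun p : 'I_d * 'I_d => is_derive_mul x
  (differentiable_scale (dw p.1) (dz p.2))
  (differentiable_cst (B (E p.1) (F p.2) : R^o) (chart_map c e))).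
rewrite (@derive_val _ _ _ _ _ _ _ dd); apply: eq_bigr => p _.
rewrite derive_cst mulr0 add0r derive_scale // chart_mapK // -mulrDl.
by congr (_ * _); rewrite addrC.
Qed.

End AdInvariance.

Section Actions.
Context {R : realType} {d k : nat} {G : lieGroup R d} {M : manifold R k}.
Variable A : smoothAction G M.
Implicit Types (X Y Z : vec G) (p : M).
Local Notation e := (lg_one G).

Lemma fundamentalE X p f : smooth_fun f ->
  fundamental A X p f = X (fun a => f (A a p)).
Proof. exact: pushE. Qed.

Lemma smooth_fun2_act f : smooth_fun f -> smooth_fun2 (fun a p => f (A a p)).
Proof. by move=> sf; apply: smooth_fun2_comp => //; apply: act_smooth. Qed.

Lemma fundamental_tangent X p : tangent e X -> tangent p (fundamental A X p).
Proof.
move=> tX; have := push_tangent (smooth_map2_slice1 p (act_smooth A)) tX.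
by rewrite act_one.
Qed.

Lemma fundamental_vfield X : tangent e X -> vfield (fundamental A X).
Proof.
move=> tX; split=> [p|f sf]; first exact: fundamental_tangent.
under eq_fun do rewrite fundamentalE //.
exact: (smooth_fun2_vec1 (smooth_fun2_act sf) tX).
Qed.

Lemma fundamental_lin (t : R) X Y p :
  fundamental A (t *: X + Y) p = t *: fundamental A X p + fundamental A Y p.
Proof. exact: push_lin. Qed.

Lemma fundamentalD X Y p :
  fundamental A (X + Y) p = fundamental A X p + fundamental A Y p.
Proof. by rewrite -[X in LHS]scale1r fundamental_lin scale1r. Qed.

Lemma fundamental0 p : fundamental A 0 p = 0.
Proof.
have := fundamental_lin (-1) 0 0 p; rewrite !scaleN1r !addNr; exact.
Qed.

Lemma fundamentalZ (t : R) X p : fundamental A (t *: X) p = t *: fundamental A X p.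
Proof. by rewrite -[t *: X]addr0 fundamental_lin fundamental0 addr0. Qed.

Lemma fundamentalN X p : fundamental A (- X) p = - fundamental A X p.
Proof. by rewrite -scaleN1r fundamentalZ scaleN1r. Qed.

Lemma fundamentalB X Y p :
  fundamental A (X - Y) p = fundamental A X p - fundamental A Y p.
Proof. by rewrite fundamentalD fundamentalN. Qed.

Lemma fundamental_sum (I : finType) (c : I -> R) (v : I -> vec G) p :
  fundamental A (\sum_i c i *: v i) p = \sum_i c i *: fundamental A (v i) p.
Proof.
elim: (index_enum I) => [|i s IH]; first by rewrite !big_nil fundamental0.
by rewrite !big_cons fundamental_lin IH.
Qed.

(** The second derivative of f along the fields of X, then Y, at p is
    X_a Y_b f(b a p), whereas left-invariant fields give X_a Y_b F(a b): the
    factors are exchanged, and so are the arguments of the bracket. *)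
Lemma lie_fundamental X Y : tangent e X -> tangent e Y ->
  lie (fundamental A X) (fundamental A Y) = fundamental A (bracket Y X).
Proof.
move=> tX tY; apply/funext => p; apply: on_smooth_ext => f sf.
have sK := smooth_fun2_act sf.
have H Z W : tangent e W ->
    fundamental A Z p (fun q => fundamental A W q f) =
    Z (fun a => W (fun b => f (A (lg_mul b a) p))).
  move=> tW; under eq_fun do rewrite fundamentalE //.
  rewrite fundamentalE; last exact: (smooth_fun2_vec1 sK tW).
  congr Z; apply/funext => a; congr W; apply/funext => b.
  by rewrite act_mul.
have sF := smooth_fun2_slice1 p sK.
have sm := smooth_fun2_mul sF.
by rewrite !H // (bracketE tY tX sF) -(tangent_comm sm tX tY)
  -(tangent_comm sm tY tX).
Qed.

(** The identity a (a^-1 b a) p = b (a p), differentiated in b. *)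
Lemma push_fundamental a Y p : push (A a) (fundamental A (Ad (lg_inv a) Y) p) =
  fundamental A Y (A a p).
Proof.
apply: on_smooth_ext => f sf.
have sfa : smooth_fun (fun q => f (A a q)) :=
  smooth_fun2_slice2 a (smooth_fun2_act sf).
rewrite fundamentalE // /Ad pushE; last first.
  exact: (smooth_fun2_slice1 p (smooth_fun2_act sfa)).
congr Y; apply/funext => b; rewrite -!act_mul; congr (f (A _ p)).
by rewrite lg_invK !lg_mulA lg_mulgV lg_mul1.
Qed.

(** Invariance moves the value at a p back to p, where Y is replaced by
    Ad (a^-1) Y. *)
Lemma invariant_form1 (l : M -> vec M -> R) X Y p :
  (forall q, linear_at q (l q)) ->
  (forall a q v, tangent q v -> l (A a q) (push (A a) v) = l q v) ->
  smooth_fun (fun q => l q (fundamental A Y q)) ->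
  tangent e X -> tangent e Y ->
  fundamental A X p (fun q => l q (fundamental A Y q)) =
  - l p (fundamental A (bracket X Y) p).
Proof.
move=> ll li sl tX tY; rewrite fundamentalE //.
apply: (Ad_invariant1 (l := fun V => l p (fundamental A V p))) => //.
- move=> t u v tu tv; rewrite fundamental_lin ll //; exact: fundamental_tangent.
- exact: (smooth_fun_comp (smooth_map2_slice1 p (act_smooth A)) sl).
- move=> a; rewrite -push_fundamental li //; apply: fundamental_tangent.
  exact: Ad_tangent.
Qed.

Lemma invariant_form2 (B : M -> vec M -> vec M -> R) X Y Z p :
  (forall q v, tangent q v -> linear_at q (B q ^~ v)) ->
  (forall q u, tangent q u -> linear_at q (B q u)) ->
  (forall a q u v, tangent q u -> tangent q v ->
     B (A a q) (push (A a) u) (push (A a) v) = B q u v) ->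
  smooth_fun (fun q => B q (fundamental A Y q) (fundamental A Z q)) ->
  tangent e X -> tangent e Y -> tangent e Z ->
  fundamental A X p (fun q => B q (fundamental A Y q) (fundamental A Z q)) =
  - B p (fundamental A (bracket X Y) p) (fundamental A Z p)
  - B p (fundamental A Y p) (fundamental A (bracket X Z) p).
Proof.
move=> Bl Br Bi sB tX tY tZ; rewrite fundamentalE //.
apply: (Ad_invariant2 (B := fun V W =>
  B p (fundamental A V p) (fundamental A W p))) => //.
- move=> w tw t u v tu tv; rewrite /= fundamental_lin Bl //;
    exact: fundamental_tangent.
- move=> w tw t u v tu tv; rewrite /= fundamental_lin Br //;
    exact: fundamental_tangent.
- exact: (smooth_fun_comp (smooth_map2_slice1 p (act_smooth A)) sB).
- move=> a; rewrite -!push_fundamental Bi //; apply: fundamental_tangent;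
    exact: Ad_tangent.
Qed.

End Actions.

Section Connections.
Context {R : realType} {d k : nat} {G : lieGroup R d} {M : manifold R k}.
Variable A : smoothAction G M.
Local Notation e := (lg_one G).

Lemma lie_jacobi (U V W : M -> vec M) p : vfield U -> vfield V -> vfield W ->
  lie (lie U V) W p + lie (lie V W) U p + lie (lie W U) V p = 0.
Proof.
move=> vU vV vW.
have lieE (S T : M -> vec M) q f : smooth_fun f ->
    lie S T q f = S q (fun r => T r f) - T q (fun r => S r f).
  by move=> sf; rewrite /lie on_smoothE.
have H (S T Q : M -> vec M) f : vfield S -> vfield T -> vfield Q -> smooth_fun f ->
    lie (lie S T) Q p f = S p (fun q => T q (fun r => Q r f)) - T p (fun q =>
      S q (fun r => Q r f))
      - (Q p (fun q => S q (fun r => T r f)) - Q p (fun q => T q (fun r => S r f))).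
  move=> vS vT vQ sf; rewrite lieE // lieE; last exact: vQ.2.
  under [in X in _ - X]eq_fun do rewrite lieE //.
  rewrite (tangent_funB (vQ.1 p)) //; first by apply: vS.2; apply: vT.2.
  by apply: vT.2; apply: vS.2.
apply/funext => f; have [sf|nsf] := pselect (smooth_fun f).
  rewrite -[LHS]/(lie (lie U V) W p f + lie (lie V W) U p f + lie (lie W U) V p f).
  rewrite !H //; rewrite -[RHS]/(0 : R); lra.
rewrite -[LHS]/(lie (lie U V) W p f + lie (lie V W) U p f + lie (lie W U) V p f).
have lie0 (S T : M -> vec M) : lie S T p f = 0 by rewrite /lie /on_smooth asboolF.
by rewrite !lie0 -[RHS]/(0 : R); lra.
Qed.

Lemma fundamental_jacobi (X Y Z : vec G) p :
  tangent e X -> tangent e Y -> tangent e Z ->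
  fundamental A (bracket Z (bracket Y X)) p
  + fundamental A (bracket X (bracket Z Y)) p
  + fundamental A (bracket Y (bracket X Z)) p = 0.
Proof.
move=> tX tY tZ.
have := lie_jacobi p (fundamental_vfield A tX) (fundamental_vfield A tY)
  (fundamental_vfield A tZ).
by rewrite !lie_fundamental //; exact: bracket_tangent.
Qed.

Section Metric.
Variable g : M -> vec M -> vec M -> R.
Hypothesis gm : riem_metric g.

Lemma metric_sym p u v : tangent p u -> tangent p v -> g p u v = g p v u.
Proof. by have [_ + _ _] := gm; apply. Qed.

Lemma metric_linl p v : tangent p v -> linear_at p (g p ^~ v).
Proof. by move=> tv k0 u w tu tw; have [+ _ _ _] := gm; apply. Qed.

Lemma metric_linr p u : tangent p u -> linear_at p (g p u).
Proof.
move=> tu k0 v w tv tw; rewrite metric_sym //; last exact: tangent_lin.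
by rewrite (metric_linl tu) // !(metric_sym (p := p) _ tu).
Qed.

Lemma metric_eq0 p u : tangent p u -> g p u u = 0 -> u = 0.
Proof.
move=> tu gu; apply: contrapT => /eqP u0; have [_ _ + _] := gm.
by move=> /(_ p u tu u0); rewrite gu ltxx.
Qed.

Lemma metric_eq p u v : tangent p u -> tangent p v ->
  g p u (u - v) = g p v (u - v) -> u = v.
Proof.
move=> tu tv E; apply/eqP; rewrite -subr_eq0; apply/eqP.
have tB := tangentB tu tv.
apply: (metric_eq0 tB).
by rewrite (linear_atB (metric_linl tB)) // E subrr.
Qed.

Lemma killing X Y Z p : isometric A g ->
  tangent e X -> tangent e Y -> tangent e Z ->
  fundamental A X p (fun q => g q (fundamental A Y q) (fundamental A Z q)) =
  - g p (fundamental A (bracket X Y) p) (fundamental A Z p)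
  - g p (fundamental A Y p) (fundamental A (bracket X Z) p).
Proof.
move=> gi tX tY tZ; apply: invariant_form2 => //.
- by move=> q v; apply: metric_linl.
- by move=> q u; apply: metric_linr.
- by have [_ _ _ +] := gm; apply; apply: fundamental_vfield.
Qed.

(** Metricity for the three choices of the differentiated argument, with the
    Killing equation in place of the derivatives of the metric, is a linear
    system in the products <nab_X Y, Z>; the skewness of the torsion solves it. *)
Lemma nomizu_koszul nab X Y Z p : isometric A g ->
  metric_connection g nab -> skew_torsion g nab ->
  tangent e X -> tangent e Y -> tangent e Z ->
  2 * g p (nab (fundamental A X) (fundamental A Y) p
           + fundamental A (bracket X Y) p) (fundamental A Z p) =
  g p (fundamental A (bracket X Y) p) (fundamental A Z p)
  - g p (fundamental A (bracket X Z) p) (fundamental A Y p)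
  - g p (fundamental A (bracket Y Z) p) (fundamental A X p)
  + g p (torsion nab (fundamental A X) (fundamental A Y) p) (fundamental A Z p).
Proof.
move=> gi [[nv _ _ _] nm] st tX tY tZ.
have vX := fundamental_vfield A tX; have vY := fundamental_vfield A tY.
have vZ := fundamental_vfield A tZ.
pose F (V : vec G) := fundamental A V p.
have tF V : tangent e V -> tangent p (F V) by apply: fundamental_tangent.
have tN (U V : vec G) : tangent e U -> tangent e V ->
    tangent p (nab (fundamental A U) (fundamental A V) p).
  by move=> tU tV; apply: (nv _ _ _ _).1; apply: fundamental_vfield.
have met (U V W : vec G) : tangent e U -> tangent e V -> tangent e W ->
   - g p (F (bracket U V)) (F W) - g p (F (bracket U W)) (F V) =
   g p (nab (fundamental A U) (fundamental A V) p) (F W) +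
   g p (nab (fundamental A U) (fundamental A W) p) (F V).
  move=> tU tV tW.
  rewrite [g p (F (bracket U W)) _]metric_sym;
    [|by apply/tF/bracket_tangent|exact: tF].
  rewrite -killing // nm; try exact: fundamental_vfield.
  by congr (_ + _); apply: metric_sym; [exact: tF|exact: tN].
have tor (U V W : vec G) : tangent e U -> tangent e V -> tangent e W ->
   g p (torsion nab (fundamental A U) (fundamental A V) p) (F W) =
   g p (nab (fundamental A U) (fundamental A V) p) (F W) -
   g p (nab (fundamental A V) (fundamental A U) p) (F W) +
   g p (F (bracket U V)) (F W).
  move=> tU tV tW; rewrite /torsion lie_fundamental // bracketC fundamentalN opprK.
  have gW := metric_linl (tF _ tW).
  rewrite (linear_atD gW) ?(linear_atB gW) //.
  - exact: tN.
  - exact: tN.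
  - by apply: tangentB; exact: tN.
  - by apply/tF/bracket_tangent.
have anti (U V W : vec G) : tangent e U -> tangent e V -> tangent e W ->
   g p (F (bracket V U)) (F W) = - g p (F (bracket U V)) (F W).
  move=> tU tV tW; rewrite bracketC /F fundamentalN.
  by rewrite (linear_atN (metric_linl (tF _ tW))) //; apply/tF/bracket_tangent.
rewrite (linear_atD (metric_linl (tF _ tZ)));
  [|exact: tN|by apply/tF/bracket_tangent].
have [t1 t2] := st _ _ _ p vX vY vZ; have [t3 t4] := st _ _ _ p vY vX vZ.
move: t1 t2 t3 t4; rewrite -!/(F _) !tor //.
have := met _ _ _ tX tY tZ; have := met _ _ _ tY tX tZ; have := met _ _ _ tZ tX tY.
rewrite !(anti X Z) // !(anti Y Z) // !(anti X Y) //.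
lra.
Qed.

End Metric.
End Connections.

(** * Almost 3-contact metric structures and the canonical connection *)

Lemma even_perm_rot i j k : even_perm i j k -> even_perm j k i.
Proof.
move=> /andP[/eqP -> /eqP ->]; rewrite /even_perm eqxx /=; apply/eqP/val_inj => /=.
by case: i => [[|[|[]]]].
Qed.

Lemma even_permE (i : 'I_3) : even_perm i (i + 1) (i + 1 + 1).
Proof. by rewrite /even_perm !eqxx. Qed.

Lemma sum_even_perm (V : nmodType) (F : 'I_3 -> V) i j k : even_perm i j k ->
  \sum_l F l = F i + F j + F k.
Proof.
move=> /andP[/eqP -> /eqP ->].
have E : \sum_l F l = F 0 + F 1 + F (1 + 1).
  rewrite !big_ord_recl big_ord0 addr0 addrA; congr (_ + F _ + F _); exact: val_inj.
rewrite E; case: i => [[|[|[|//]]] hi].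
- by congr (F _ + F _ + F _); apply: val_inj.
- by rewrite -addrA addrC; congr (F _ + F _ + F _); apply: val_inj.
- by rewrite addrC addrA; congr (F _ + F _ + F _); apply: val_inj.
Qed.

Section Almost3Contact.
Context {R : realType} {d : nat} {M : manifold R d} {S : contact3_data M}.
Hypothesis h3 : almost_3_contact_metric S.
Implicit Types (p : M) (u v : vec M).
Let g := met S.

Lemma contact3_metric : riem_metric g.
Proof. by have [[[]]] := h3.1 0. Qed.

Lemma eta_linear i p : linear_at p (eta S i p).
Proof. by move=> t u v tu tv; have [[_ _ _ [+ _]] _] := h3.1 i; apply. Qed.

Lemma phi_tangent i p v : tangent p v -> tangent p (phi S i p v).
Proof. by have [[_ [+ _ _] _ _] _] := h3.1 i; apply. Qed.

Lemma phi_lin i p t u v : tangent p u -> tangent p v ->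
  phi S i p (t *: u + v) = t *: phi S i p u + phi S i p v.
Proof. by have [[_ [_ + _] _ _] _] := h3.1 i; apply. Qed.

Lemma phi_vfield i X : vfield X -> vfield (fun p => phi S i p (X p)).
Proof. by have [[_ [_ _ +] _ _] _] := h3.1 i; apply. Qed.

Lemma xi_vfield i : vfield (xi S i).
Proof. by have [[]] := h3.1 i. Qed.

Lemma xi_tangent i p : tangent p (xi S i p).
Proof. by have [+ _] := xi_vfield i; apply. Qed.

Lemma phi0 i p : phi S i p 0 = 0.
Proof.
have t0 := tangent0 p; have := phi_lin i (-1) t0 t0.
by rewrite !scaleN1r !addNr.
Qed.

Lemma phiN i p u : tangent p u -> phi S i p (- u) = - phi S i p u.
Proof.
by move=> tu; have := phi_lin i (-1) tu (tangent0 p); rewrite phi0 !addr0 !scaleN1r.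
Qed.

Lemma phiD i p u v : tangent p u -> tangent p v ->
  phi S i p (u + v) = phi S i p u + phi S i p v.
Proof. by move=> tu tv; have := phi_lin i 1 tu tv; rewrite !scale1r. Qed.

Lemma phiZ i p t u : tangent p u -> phi S i p (t *: u) = t *: phi S i p u.
Proof. by move=> tu; have := phi_lin i t tu (tangent0 p); rewrite phi0 !addr0. Qed.

Lemma phi_phi i p v : tangent p v ->
  phi S i p (phi S i p v) = - v + eta S i p v *: xi S i p.
Proof. by have [_ /(_ p)[+ _ _ _ _]] := h3.1 i; apply. Qed.

Lemma eta_xi_id i p : eta S i p (xi S i p) = 1.
Proof. by have [_ /(_ p)[]] := h3.1 i. Qed.

Lemma phi_xi_id i p : phi S i p (xi S i p) = 0.
Proof. by have [_ /(_ p)[]] := h3.1 i. Qed.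

Lemma eta_phi_id i p v : tangent p v -> eta S i p (phi S i p v) = 0.
Proof. by have [_ /(_ p)[_ _ _ + _]] := h3.1 i; apply. Qed.

Lemma met_phi_phi i p u v : tangent p u -> tangent p v ->
  g p (phi S i p u) (phi S i p v) = g p u v - eta S i p u * eta S i p v.
Proof. by have [_ /(_ p)[_ _ _ _ +]] := h3.1 i; apply. Qed.

Lemma met_xi i p u : tangent p u -> g p u (xi S i p) = eta S i p u.
Proof.
move=> tu; have := met_phi_phi i tu (xi_tangent i p).
rewrite phi_xi_id (linear_at0 (metric_linr contact3_metric (phi_tangent i tu))).
by rewrite eta_xi_id mulr1 => /eqP; rewrite eq_sym subr_eq0 => /eqP.
Qed.

Lemma met_phi i p u v : tangent p u -> tangent p v ->
  g p u (phi S i p v) = - g p (phi S i p u) v.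
Proof.
move=> tu tv; have tpv := phi_tangent i tv; have tpu := phi_tangent i tu.
have := met_phi_phi i tu tpv; rewrite eta_phi_id // mulr0 subr0 => <-.
have tv' := tangentN tv; have tx := tangentZ (eta S i p v) (xi_tangent i p).
have lr := metric_linr contact3_metric tpu.
rewrite phi_phi // (linear_atD lr) // (linear_atN lr) // (linear_atZ _ lr);
  last exact: xi_tangent.
by rewrite met_xi // eta_phi_id // mulr0 addr0.
Qed.

Section EvenPerm.
Variables (i j k : 'I_3).
Hypothesis ev : even_perm i j k.

Lemma phi_xi_next p : phi S i p (xi S j p) = xi S k p.
Proof. by have [_ [-> _] _] := h3.2 i j k p ev. Qed.

Lemma phi_xi_prev p : phi S j p (xi S i p) = - xi S k p.
Proof. by have [_ [_ ->] _] := h3.2 i j k p ev; rewrite opprK. Qed.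

Lemma eta_xi_ik p : eta S i p (xi S k p) = 0.
Proof. by rewrite -phi_xi_next eta_phi_id //; apply: xi_tangent. Qed.

Lemma eta_xi_jk p : eta S j p (xi S k p) = 0.
Proof.
by rewrite -[xi S k p]opprK -phi_xi_prev (linear_atN (@eta_linear j p)) ?eta_phi_id
   ?oppr0 //; [exact: xi_tangent|apply: phi_tangent; exact: xi_tangent].
Qed.

Lemma eta_phi_next p v : tangent p v -> eta S i p (phi S j p v) = eta S k p v.
Proof. by move=> tv; have [_ _ /(_ v tv)[->]] := h3.2 i j k p ev. Qed.

Lemma eta_phi_prev p v : tangent p v -> eta S j p (phi S i p v) = - eta S k p v.
Proof. by move=> tv; have [_ _ /(_ v tv)[_ ->]] := h3.2 i j k p ev;
  rewrite opprK. Qed.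

End EvenPerm.

Lemma eta_xi i j p : eta S i p (xi S j p) = (i == j)%:R.
Proof.
have e1 := even_permE i; have e2 := even_perm_rot e1; have e3 := even_perm_rot e2.
have : j \in [:: i; i + 1; i + 1 + 1].
  by case: i {e1 e2 e3} => [[|[|[]]]] // hi; case: j => [[|[|[]]]].
rewrite !inE => /or3P[] /eqP ->.
- by rewrite eqxx eta_xi_id.
- rewrite (eta_xi_jk e3); case: eqP => // E; exfalso; move: E => /(congr1 val) /=.
  by case: i {e1 e2 e3} => [[|[|[]]]].
- rewrite (eta_xi_ik e1); case: eqP => // E; exfalso; move: E => /(congr1 val) /=.
  by case: i {e1 e2 e3} => [[|[|[]]]].
Qed.

Lemma eta_phi_hor i j p v : tangent p v -> (forall l, eta S l p v = 0) ->
  eta S j p (phi S i p v) = 0.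
Proof.
move=> tv hv.
have e1 := even_permE i; have e2 := even_perm_rot e1; have e3 := even_perm_rot e2.
have : j \in [:: i; i + 1; i + 1 + 1].
  by case: i {e1 e2 e3} => [[|[|[]]]] // hi; case: j => [[|[|[]]]].
rewrite !inE => /or3P[] /eqP ->.
- exact: eta_phi_id.
- by rewrite (eta_phi_prev e1) // hv oppr0.
- by rewrite (eta_phi_next e3) // hv.
Qed.

Lemma met_hor_vert p u v : tangent p u -> (forall l, eta S l p u = 0) ->
  vertical_space S p v -> g p u v = 0.
Proof.
move=> tu hu [c ->].
rewrite (linear_at_sum _ (metric_linr contact3_metric tu)); last by move=> i;
  apply: xi_tangent.
by rewrite big1 // => i _; rewrite met_xi // hu mulr0.
Qed.

Lemma vertical_tangent p v : vertical_space S p v -> tangent p v.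
Proof.
by move=> [c ->]; apply: tangent_sum => i; apply/tangentZ/xi_tangent.
Qed.

Lemma verticalE p v : vertical_space S p v -> v = \sum_i eta S i p v *: xi S i p.
Proof.
move=> [c vE]; rewrite {1}vE; apply: eq_bigr => i _; congr (_ *: _).
rewrite vE (linear_at_sum _ (@eta_linear i p)); last by move=> l; apply: xi_tangent.
rewrite (bigD1 i) //= eta_xi eqxx mulr1 big1 ?addr0 // => l li.
by rewrite eta_xi eq_sym (negbTE li) mulr0.
Qed.

Lemma met_vert p u v : tangent p u -> vertical_space S p v ->
  g p u v = \sum_i eta S i p v * eta S i p u.
Proof.
move=> tu vv; rewrite {1}(verticalE vv).
rewrite (linear_at_sum _ (metric_linr contact3_metric tu)); last by move=> i;
  apply: xi_tangent.
by apply: eq_bigr => i _; rewrite met_xi.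
Qed.

Definition horizontal_part p u := u - \sum_i eta S i p u *: xi S i p.

Lemma horizontal_part_tangent p u : tangent p u -> tangent p (horizontal_part p u).
Proof.
by move=> tu; apply: tangentB => //; apply: tangent_sum => i;
  apply/tangentZ/xi_tangent.
Qed.

Lemma eta_horizontal_part i p u :
  tangent p u -> eta S i p (horizontal_part p u) = 0.
Proof.
move=> tu; rewrite /horizontal_part (linear_atB (@eta_linear i p)) //; last first.
  by apply: tangent_sum => l; apply/tangentZ/xi_tangent.
rewrite (linear_at_sum _ (@eta_linear i p)); last by move=> l; apply: xi_tangent.
rewrite (bigD1 i) //= eta_xi eqxx mulr1 big1 ?addr0 ?subrr // => l li.
by rewrite eta_xi eq_sym (negbTE li) mulr0.
Qed.

(** The difference u - v is itself horizontal, and orthogonal to itself. *)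
Lemma contact3_ext p u v : tangent p u -> tangent p v ->
  (forall i, eta S i p u = eta S i p v) ->
  (forall w, tangent p w -> (forall i, eta S i p w = 0) -> g p u w = g p v w) ->
  u = v.
Proof.
move=> tu tv euv guv; apply: (metric_eq contact3_metric tu tv); apply: guv.
  exact: tangentB.
by move=> i; rewrite (linear_atB (@eta_linear i p)) // euv subrr.
Qed.

Variables (al de : R) (nab : (M -> vec M) -> (M -> vec M) -> M -> vec M).
Hypothesis hc : canonical_connection S al de nab.

Lemma canonical_vfield X Y : vfield X -> vfield Y -> vfield (nab X Y).
Proof. by have [[[+ _ _ _] _] _ _] := hc; apply. Qed.

Lemma canonical_metric X Y Z p : vfield X -> vfield Y -> vfield Z ->
  X p (fun q => g q (Y q) (Z q)) = g p (nab X Y p) (Z p) + g p (Y p) (nab X Z p).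
Proof. by have [[_ +] _ _] := hc; apply. Qed.

Lemma nab_zero X : vfield X -> nab X (fun _ => 0) = fun _ => 0.
Proof.
move=> vX; have [[[_ _ _ H] _] _ _] := hc.
have := H (fun _ => 0) X (xi S 0) (smooth_fun_cst 0) vX (xi_vfield 0).
have -> : (fun p => (0 : R) *: xi S 0 p) = fun _ => 0.
  by apply/funext => p; rewrite scale0r.
move=> ->; apply/funext => p; rewrite (tangent_cst _ (vX.1 p)).
by rewrite !scale0r addr0.
Qed.

(** As phi_i xi_i = 0, the formula for nab phi_i applied to xi_i computes
    phi_i (nab_X xi_i). Since xi_i has length 1, nab_X xi_i is orthogonal to it,
    and on such vectors - phi_i inverts phi_i. *)
Lemma nab_xi i j k X p : even_perm i j k -> vfield X ->
  nab X (xi S i) p = beta al de *: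
    (eta S k p (X p) *: xi S j p - eta S j p (X p) *: xi S k p).
Proof.
move=> ev vX; set u := nab X (xi S i) p.
have ev2 := even_perm_rot ev; have ev3 := even_perm_rot ev2.
have tu : tangent p u by apply: (canonical_vfield vX (xi_vfield i)).1.
have tx l := xi_tangent l p.
have eu : eta S i p u = 0.
  have := canonical_metric p vX (xi_vfield i) (xi_vfield i).
  have -> : (fun q => g q (xi S i q) (xi S i q)) = fun _ => 1.
    by apply/funext => q; rewrite met_xi ?eta_xi_id //; apply: xi_tangent.
  rewrite (tangent_cst _ (vX.1 p)) -/u (metric_sym contact3_metric (tx i) tu)
    met_xi // => E.
  lra.
have [_ _ hphi] := hc.
have := hphi i j k ev X (xi S i) p vX (xi_vfield i).
have -> : (fun q => phi S i q (xi S i q)) = fun _ => 0.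
  by apply/funext => q; rewrite phi_xi_id.
rewrite nab_zero // sub0r -/u (phi_xi_prev ev) (phi_xi_next ev3) => E.
have := congr1 (phi S i p) E.
rewrite phiN ?phi_phi ?eu ?scale0r ?addr0 ?opprK //; last exact: phi_tangent.
move=> ->; rewrite phiZ; last first.
  by apply: tangentB; apply: tangentZ => //; apply: tangentN.
congr (_ *: _); rewrite phiD; [|by apply/tangentZ/tangentN|by
  apply/tangentN/tangentZ].
rewrite phiZ; last exact: tangentN.
rewrite phiN // phiN; last exact: tangentZ.
by rewrite phiZ // (phi_xi_prev ev3) (phi_xi_next ev) opprK.
Qed.

(** eta_i is the metric dual of xi_i, so this is nab_xi. *)
Lemma eta_nab i j k X Y p : even_perm i j k -> vfield X -> vfield Y ->
  eta S i p (nab X Y p) = X p (fun q => eta S i q (Y q))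
   - beta al de * (eta S k p (X p) * eta S j p (Y p) - eta S j p (X p)
       * eta S k p (Y p)).
Proof.
move=> ev vX vY; have := canonical_metric p vX vY (xi_vfield i).
have -> : (fun q => g q (Y q) (xi S i q)) = fun q => eta S i q (Y q).
  by apply/funext => q; apply: met_xi; apply: vY.1.
move=> ->; rewrite (nab_xi _ ev vX) met_xi; last exact: (canonical_vfield vX vY).1.
have tx l := xi_tangent l p; have gl := metric_linr contact3_metric (vY.1 p).
rewrite (linear_atZ _ gl); last by apply: tangentB; apply: tangentZ.
rewrite (linear_atB gl); [|exact: tangentZ|exact: tangentZ].
rewrite !(linear_atZ _ gl) // !met_xi; try exact: vY.1.
by rewrite addrK.
Qed.

End Almost3Contact.

(** * The vectors of the Nomizu map on a homogeneous 3-Sasaki manifold *)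

Section HomogeneousSasaki.
Context {R : realType} {n d : nat} {G : lieGroup R d} {M : manifold R (4 * n + 3)}.
Context {S : contact3_data M} {al de : R} {A : smoothAction G M} {p : M}.
Context {nab : (M -> vec M) -> (M -> vec M) -> M -> vec M}.
Hypothesis hS : sasaki3 S al de.
Hypothesis hiso : isometric A (met S).
Hypothesis hpres : preserves3 A S.
Hypothesis hnab : canonical_connection S al de nab.
Hypothesis hlift : forall v, tangent p v ->
  exists2 X, lie_algebra X & fundamental A X p = v.
Implicit Types (X Y Z : vec G).
Local Notation e := (lg_one G).
Local Notation F X := (fundamental A X p).
Local Notation b := (beta al de).

Definition horizontal X := forall i, eta S i p (F X) = 0.
Definition vertical X := vertical_space S p (F X).
Definition bracket_form X Y Z := met S p (F (bracket X Y)) (F Z).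
(** The tangent vector at p that the Nomizu map represents: the bracket of the
    fundamental fields of X and Y is minus that of [X, Y]. *)
Definition nomizu_vector X Y :=
  nab (fundamental A X) (fundamental A Y) p + F (bracket X Y).
Definition torsion_form X Y Z :=
  met S p (torsion nab (fundamental A X) (fundamental A Y) p) (F Z).

Let h3 : almost_3_contact_metric S. Proof. by have [] := hS. Qed.
Let gm := contact3_metric h3.
Let tF X : tangent e X -> tangent p (F X). Proof. exact: fundamental_tangent. Qed.
Let tFb X Y : tangent e X -> tangent e Y -> tangent p (F (bracket X Y)).
Proof. by move=> tX tY; apply/tF/bracket_tangent. Qed.
Let vF X : tangent e X -> vfield (fundamental A X).
Proof. exact: fundamental_vfield. Qed.

Lemma nab_tangent X Y : tangent e X -> tangent e Y ->
  tangent p (nab (fundamental A X) (fundamental A Y) p).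
Proof. by move=> tX tY; apply: (canonical_vfield hnab (vF tX) (vF tY)).1. Qed.

Lemma nomizu_vector_tangent X Y :
  tangent e X -> tangent e Y -> tangent p (nomizu_vector X Y).
Proof. by move=> tX tY; apply: tangentD; [exact: nab_tangent|exact: tFb]. Qed.

Lemma torsion_nomizu X Y : tangent e X -> tangent e Y ->
  torsion nab (fundamental A X) (fundamental A Y) p =
  nomizu_vector X Y - nomizu_vector Y X - F (bracket X Y).
Proof.
move=> tX tY; rewrite /torsion lie_fundamental // /nomizu_vector bracketC
  fundamentalN.
by rewrite opprK opprB [RHS]addrAC addrK -addrA; congr (_ + _); rewrite addrC.
Qed.

Lemma torsion_tangent X Y : tangent e X -> tangent e Y ->
  tangent p (torsion nab (fundamental A X) (fundamental A Y) p).
Proof.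
move=> tX tY; rewrite torsion_nomizu //.
by apply: tangentB; [apply: tangentB; exact: nomizu_vector_tangent|exact: tFb].
Qed.

Lemma bracket_form_anti X Y Z : tangent e X -> tangent e Y -> tangent e Z ->
  bracket_form Y X Z = - bracket_form X Y Z.
Proof.
move=> tX tY tZ; rewrite /bracket_form bracketC fundamentalN.
by rewrite (linear_atN (metric_linl gm (tF tZ))) //; exact: tFb.
Qed.

Lemma torsion_form_swap12 X Y Z : tangent e X -> tangent e Y -> tangent e Z ->
  torsion_form Y X Z = - torsion_form X Y Z.
Proof.
move=> tX tY tZ; have [_ st _] := hnab.
by have [E _] := st _ _ _ p (vF tX) (vF tY) (vF tZ); rewrite /torsion_form E opprK.
Qed.

Lemma torsion_form_swap23 X Y Z : tangent e X -> tangent e Y -> tangent e Z ->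
  torsion_form X Z Y = - torsion_form X Y Z.
Proof.
move=> tX tY tZ; have [_ st _] := hnab.
by have [_ E] := st _ _ _ p (vF tX) (vF tY) (vF tZ); rewrite /torsion_form E opprK.
Qed.

Lemma torsion_form_cycle X Y Z : tangent e X -> tangent e Y -> tangent e Z ->
  torsion_form Y Z X = torsion_form X Y Z.
Proof.
by move=> tX tY tZ; rewrite torsion_form_swap23 // torsion_form_swap12 // opprK.
Qed.

Lemma torsion_formN X Y Z : tangent e X -> tangent e Y -> tangent e Z ->
  torsion_form X Y (- Z) = - torsion_form X Y Z.
Proof.
move=> tX tY tZ; rewrite /torsion_form fundamentalN.
by rewrite (linear_atN (metric_linr gm (torsion_tangent tX tY))) //; exact: tF.
Qed.

Lemma koszul X Y Z : tangent e X -> tangent e Y -> tangent e Z ->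
  2 * met S p (nomizu_vector X Y) (F Z) =
  bracket_form X Y Z - bracket_form X Z Y - bracket_form Y Z X
  + torsion_form X Y Z.
Proof.
by move=> tX tY tZ; have [mc st _] := hnab; apply: nomizu_koszul.
Qed.

Lemma deriv_eta i X Y : tangent e X -> tangent e Y ->
  F X (fun q => eta S i q (fundamental A Y q)) = - eta S i p (F (bracket X Y)).
Proof.
move=> tX tY; apply: invariant_form1 => //.
- by move=> q; apply: eta_linear.
- by move=> a q v tv; have [_ _] := hpres i a q; apply.
- by have [[_ _ _ [_ +]] _] := h3.1 i; apply; apply: vF.
Qed.

(** By invariance d eta_i takes the value - eta_i ([X, Y]) on fundamental fields,
    so this is the structure equation. *)
Lemma eta_bracket i j k X Y : even_perm i j k -> tangent e X -> tangent e Y ->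
  eta S i p (F (bracket X Y)) = - (2 * al * met S p (F X) (phi S i p (F Y))
   + 2 * (al - de) *
     (eta S j p (F X) * eta S k p (F Y) - eta S j p (F Y) * eta S k p (F X))).
Proof.
move=> ev tX tY; have [_ _ /(_ i j k ev _ _ p (vF tX) (vF tY))] := hS.
rewrite /ext_d !deriv_eta // lie_fundamental // bracketC fundamentalN.
rewrite (linear_atN (@eta_linear _ _ _ _ h3 i p)); last exact: tFb.
by rewrite /wedge /fund_form => E; lra.
Qed.

(** Invariance turns the derivative of eta_i (Y) along X into - eta_i ([X, Y]),
    which cancels the bracket term; what remains comes from nab xi_i. *)
Lemma eta_nomizu i j k X Y : even_perm i j k -> tangent e X -> tangent e Y ->
  eta S i p (nomizu_vector X Y) =
  b * (eta S j p (F X) * eta S k p (F Y) - eta S k p (F X) * eta S j p (F Y)).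
Proof.
move=> ev tX tY; rewrite /nomizu_vector (linear_atD (@eta_linear _ _ _ _ h3 i p));
  last exact: tFb.
  rewrite (eta_nab h3 hnab p ev (vF tX) (vF tY)) deriv_eta //; lra.
exact: nab_tangent.
Qed.

Lemma eta_torsion i j k X Y : even_perm i j k -> tangent e X -> tangent e Y ->
  eta S i p (torsion nab (fundamental A X) (fundamental A Y) p) =
  2 * b * (eta S j p (F X) * eta S k p (F Y) - eta S k p (F X) * eta S j p (F Y))
  - eta S i p (F (bracket X Y)).
Proof.
move=> ev tX tY; rewrite torsion_nomizu //.
have el := @eta_linear _ _ _ _ h3 i p.
have tXY := nomizu_vector_tangent tX tY; have tYX := nomizu_vector_tangent tY tX.
rewrite (linear_atB el) ?(linear_atB el) //; [|exact: tangentB|exact: tFb].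
by rewrite !(eta_nomizu ev) //; lra.
Qed.

(** For horizontal X, phi_i is parallel along X. The function <phi_i Y, Z> is
    differentiated along X in two ways, through the connection and through
    invariance. *)
Lemma nomizu_phi i X Y Z : tangent e X -> tangent e Y -> tangent e Z ->
  horizontal X ->
  met S p (nomizu_vector X Y) (phi S i p (F Z)) =
    met S p (nomizu_vector X Z) (phi S i p (F Y)).
Proof.
move=> tX tY tZ hX; have ev := even_permE i.
have E1 : F X (fun q => met S q (phi S i q (fundamental A Y q))
  (fundamental A Z q)) =
   - met S p (phi S i p (F (bracket X Y))) (F Z)
   - met S p (phi S i p (F Y)) (F (bracket X Z)).
  apply: (invariant_form2 (B := fun q u v => met S q (phi S i q u) v)) => //.
  - move=> q v tv t u w tu tw; rewrite (phi_lin h3) //.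
    by apply: (metric_linl gm tv); apply: (phi_tangent h3).
  - by move=> q u tu; apply: (metric_linr gm); apply: (phi_tangent h3).
  - move=> a q u v tu tv; have [hp _ _] := hpres i a q.
    by rewrite hp // hiso //; apply: (phi_tangent h3).
  - have [_ _ _ gs] := gm; apply: gs; last exact: vF.
    exact: (phi_vfield h3 i (vF tY)).
have := canonical_metric hnab p (vF tX) (phi_vfield h3 i (vF tY)) (vF tZ).
rewrite E1; have [_ _ hphi] := hnab.
have := hphi _ _ _ ev _ _ p (vF tX) (vF tY).
rewrite !hX !scale0r subrr scaler0 => /eqP; rewrite subr_eq0 => /eqP -> E2.
have tnY := nab_tangent tX tY; have tnZ := nab_tangent tX tZ.
have tpY := phi_tangent h3 i (tF tY); have tpZ := phi_tangent h3 i (tF tZ).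
rewrite /nomizu_vector (linear_atD (metric_linl gm tpZ))
  ?(linear_atD (metric_linl gm tpY)) //;
  try exact: tFb.
rewrite !(met_phi h3 i tnY (tF tZ)) !(met_phi h3 i (tFb tX tY) (tF tZ)).
rewrite (metric_sym gm tnZ tpY) (metric_sym gm (tFb tX tZ) tpY).
lra.
Qed.

Lemma lift_phi i X : tangent e X ->
  exists2 X', tangent e X' & F X' = phi S i p (F X).
Proof. by move=> tX; apply: hlift; apply: (phi_tangent h3); apply: tF. Qed.

Lemma horizontal_lift_phi i X X' :
  tangent e X -> horizontal X -> F X' = phi S i p (F X) -> horizontal X'.
Proof. by move=> tX hX E j; rewrite E (eta_phi_hor h3 i j (tF tX)). Qed.

(** The closedness of d eta_i: eta_bracket is applied to the Jacobi identity, and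
    the terms in eta_j /\ eta_k vanish on horizontal vectors. *)
Lemma bracket_phi_cyclic i X Y Z : tangent e X -> tangent e Y -> tangent e Z ->
  horizontal X -> horizontal Y -> horizontal Z ->
  met S p (F (bracket X Y)) (phi S i p (F Z)) +
  met S p (F (bracket Y Z)) (phi S i p (F X)) +
  met S p (F (bracket Z X)) (phi S i p (F Y)) = 0.
Proof.
move=> tX tY tZ hX hY hZ; have ev := even_permE i; have [al0 _ _] := hS.
have H U V W : tangent e U -> tangent e V -> tangent e W -> horizontal U ->
  horizontal V -> horizontal W ->
    eta S i p (F (bracket W (bracket V U))) =
    - 2 * al * met S p (F (bracket U V)) (phi S i p (F W)).
  move=> tU tV tW hU hV hW; have tb := bracket_tangent tV tU.
  rewrite (eta_bracket ev tW tb) !hW bracketC fundamentalN.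
  have tUV := tFb tU tV; have tpW := phi_tangent h3 i (tF tW).
  rewrite (met_phi h3 i (tF tW)); last exact: tangentN.
  rewrite (linear_atN (metric_linr gm tpW)) // (metric_sym gm tpW) //.
  lra.
have tb U V W : tangent e U -> tangent e V -> tangent e W ->
    tangent p (F (bracket W (bracket V U))).
  by move=> tU tV tW; apply/tFb/bracket_tangent.
have el := @eta_linear _ _ _ _ h3 i p.
have := congr1 (eta S i p) (fundamental_jacobi A p tX tY tZ).
rewrite (linear_at0 el) (linear_atD el) ?(linear_atD el) //; try (by apply: tb);
  last by apply: tangentD; apply: tb.
rewrite !H // => E; apply: (mulfI al0); rewrite mulr0; lra.
Qed.

(** The cyclic sum of nomizu_phi, expanded by koszul: the brackets of a vector
    with a rotated one cancel in pairs, and the others form the sum in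
    bracket_phi_cyclic. The conclusion says that phi_i, as a derivation,
    annihilates the torsion on horizontal vectors. *)
Lemma torsion_form_phi_cyclic i X Y Z X' Y' Z' :
  tangent e X -> tangent e Y -> tangent e Z ->
  tangent e X' -> tangent e Y' -> tangent e Z' ->
  horizontal X -> horizontal Y -> horizontal Z ->
  F X' = phi S i p (F X) -> F Y' = phi S i p (F Y) -> F Z' = phi S i p (F Z) ->
  torsion_form X Y Z' + torsion_form Y Z X' + torsion_form Z X Y' = 0.
Proof.
move=> tX tY tZ tX' tY' tZ' hX hY hZ EX EY EZ.
have := bracket_phi_cyclic i tX tY tZ hX hY hZ.
rewrite -EX -EY -EZ -/(bracket_form X Y Z') -/(bracket_form Y Z X')
  -/(bracket_form Z X Y').
have := nomizu_phi i tX tY tZ hX; have := nomizu_phi i tY tZ tX hY;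
  have := nomizu_phi i tZ tX tY hZ.
rewrite -EX -EY -EZ.
have := koszul tX tY tZ'; have := koszul tX tZ tY'.
have := koszul tY tZ tX'; have := koszul tY tX tZ'.
have := koszul tZ tX tY'; have := koszul tZ tY tX'.
rewrite (torsion_form_swap12 tX tY tZ') (torsion_form_swap12 tZ tX tY')
  (torsion_form_swap12 tY tZ tX').
rewrite (bracket_form_anti tX tY tZ') (bracket_form_anti tZ tX tY')
  (bracket_form_anti tY tZ tX').
move=> *; lra.
Qed.

(** Let a, b, c be the torsion of (X, Y, Z) with phi applied to the first, the
    second, the third argument. The relation of torsion_form_phi_cyclic is
    a + b + c = 0 for (X, Y, Z), and for the triples with two rotated arguments
    it equates a + b, b + c and c + a with the torsion of
    (phi X, phi Y, phi Z). Hence a = b = c = 0, and phi is onto the horizontal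
    vectors. *)
Lemma torsion_form_hor0 X Y Z : tangent e X -> tangent e Y -> tangent e Z ->
  horizontal X -> horizontal Y -> horizontal Z -> torsion_form X Y Z = 0.
Proof.
move=> tX tY tZ hX hY hZ; pose i : 'I_3 := 0.
have phi2 W W' : tangent e W -> horizontal W -> F W' = phi S i p (F W) ->
    F (- W) = phi S i p (F W').
  move=> tW hW ->; rewrite (phi_phi h3) ?hW ?scale0r ?addr0 ?fundamentalN //;
    exact: tF.
have main U V W W' : tangent e U -> tangent e V -> tangent e W -> tangent e W' ->
    horizontal U -> horizontal V -> horizontal W -> F W' = phi S i p (F W) ->
      torsion_form U V W' = 0.
  move=> tU tV tW tW' hU hV hW EW.
  have [U' tU' EU] := lift_phi i tU; have [V' tV' EV] := lift_phi i tV.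
  have hU' := horizontal_lift_phi tU hU EU;
    have hV' := horizontal_lift_phi tV hV EV.
  have hW' := horizontal_lift_phi tW hW EW.
  have tNU := tangentN tU; have tNV := tangentN tV; have tNW := tangentN tW.
  have := torsion_form_phi_cyclic tU tV tW tU' tV' tW' hU hV hW EU EV EW.
  have := torsion_form_phi_cyclic tU' tV' tW tNU tNV tW' hU' hV' hW
    (phi2 _ _ tU hU EU) (phi2 _ _ tV hV EV) EW.
  have := torsion_form_phi_cyclic tV' tW' tU tNV tNW tU' hV' hW' hU
    (phi2 _ _ tV hV EV) (phi2 _ _ tW hW EW) EU.
  have := torsion_form_phi_cyclic tW' tU' tV tNW tNU tV' hW' hU' hV
    (phi2 _ _ tW hW EW) (phi2 _ _ tU hU EU) EV.
  rewrite !torsion_formN // (torsion_form_cycle tV' tW' tU')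
    (torsion_form_cycle tU' tV' tW').
  rewrite (torsion_form_cycle tU tV' tW) (torsion_form_cycle tW tU tV')
    (torsion_form_cycle tW tU' tV) (torsion_form_cycle tV tW tU').
  rewrite (torsion_form_cycle tV tW' tU) (torsion_form_cycle tU tV tW').
  move=> *; lra.
have [W tW EW] := lift_phi i tZ; have hW := horizontal_lift_phi tZ hZ EW.
have tNZ := tangentN tZ.
have := main X Y W (- Z) tX tY tW tNZ hX hY hW (phi2 _ _ tZ hZ EW).
by rewrite torsion_formN // => /eqP; rewrite oppr_eq0 => /eqP.
Qed.

Lemma eta_bracket_vertical i X Y :
  tangent e X -> tangent e Y -> vertical X -> horizontal Y ->
  eta S i p (F (bracket X Y)) = 0.
Proof.
move=> tX tY vX hY; have ev := even_permE i.
rewrite (eta_bracket ev tX tY) !hY (metric_sym gm (tF tX)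
  (phi_tangent h3 i (tF tY))).
rewrite (met_hor_vert h3 (phi_tangent h3 i (tF tY))) //; first by lra.
by move=> l; apply: (eta_phi_hor h3 i l (tF tY)).
Qed.

Lemma bracket_form_vertical X Y Z :
  tangent e X -> tangent e Y -> tangent e Z -> vertical Z ->
  bracket_form X Y Z = \sum_i eta S i p (F Z) * eta S i p (F (bracket X Y)).
Proof.
by move=> tX tY tZ vZ; rewrite /bracket_form (met_vert h3 (tFb tX tY) vZ).
Qed.

(** With one argument horizontal, eta_i (T(X, Y)) = - eta_i ([X, Y]). *)
Lemma torsion_form_vertical X Y Z :
  tangent e X -> tangent e Y -> tangent e Z -> vertical Z -> horizontal Y ->
  torsion_form X Y Z = - bracket_form X Y Z.
Proof.
move=> tX tY tZ vZ hY; rewrite (bracket_form_vertical tX tY tZ vZ)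
  -sumrN /torsion_form.
rewrite (met_vert h3 (torsion_tangent tX tY) vZ); apply: eq_bigr => i _.
rewrite (eta_torsion (even_permE i) tX tY) !hY; lra.
Qed.

Lemma eta_nomizu_hor_l i X Y : tangent e X -> tangent e Y -> horizontal X ->
  eta S i p (nomizu_vector X Y) = 0.
Proof.
by move=> tX tY hX; rewrite (eta_nomizu (even_permE i) tX tY) !hX; lra.
Qed.

Lemma eta_nomizu_hor_r i X Y : tangent e X -> tangent e Y -> horizontal Y ->
  eta S i p (nomizu_vector X Y) = 0.
Proof.
by move=> tX tY hY; rewrite (eta_nomizu (even_permE i) tX tY) !hY; lra.
Qed.

Lemma nomizu_ext X Y v : tangent e X -> tangent e Y -> tangent p v ->
  (forall i, eta S i p (nomizu_vector X Y) = eta S i p v) ->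
  (forall Z, tangent e Z -> horizontal Z ->
    met S p (nomizu_vector X Y) (F Z) = met S p v (F Z)) ->
  nomizu_vector X Y = v.
Proof.
move=> tX tY tv Ee Eh; apply: (contact3_ext h3 (nomizu_vector_tangent tX tY) tv Ee).
by move=> w tw hw; have [Z tZ FZ] := hlift tw; rewrite -FZ Eh // => i; rewrite FZ.
Qed.

(** In the Koszul formula the torsion cancels - <[X, Z], Y>, and the remaining
    two terms cancel by skewness. *)
Lemma nomizu_hor_ver X Y : tangent e X -> tangent e Y -> horizontal X ->
  vertical Y ->
  (forall Z, tangent e Z -> horizontal Z ->
    bracket_form Y X Z + bracket_form Y Z X = 0) ->
  nomizu_vector X Y = 0.
Proof.
move=> tX tY hX vY skew; apply: nomizu_ext => //; first exact: tangent0.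
  by move=> i; rewrite eta_nomizu_hor_l // (linear_at0 (@eta_linear _ _ _ _ h3 i
    p)).
move=> Z tZ hZ; rewrite (linear_at0 (metric_linl gm (tF tZ))).
have := koszul tX tY tZ; have := skew Z tZ hZ.
rewrite (bracket_form_anti tX tY tZ) (torsion_form_swap23 tX tZ tY)
  (torsion_form_vertical tX tZ tY vY hZ).
lra.
Qed.

(** In the Koszul formula - <[X, Z], Y> equals <[X, Y], Z> by skewness, and the
    torsion equals - <[Y, Z], X>, which eta_bracket expresses through the
    phi_i Y. *)
Lemma nomizu_ver_hor X Y : tangent e X -> tangent e Y -> vertical X ->
  horizontal Y ->
  (forall Z, tangent e Z -> horizontal Z ->
    bracket_form X Y Z + bracket_form X Z Y = 0) ->
  nomizu_vector X Y = F (bracket X Y)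
    - (2 * al) *: \sum_i eta S i p (F X) *: phi S i p (F Y).
Proof.
move=> tX tY vX hY skew.
have tp i : tangent p (phi S i p (F Y)) by apply: (phi_tangent h3); apply: tF.
have ts : tangent p (\sum_i eta S i p (F X) *: phi S i p (F Y)).
  by apply: tangent_sum => i; apply: tangentZ.
have tb := tFb tX tY.
apply: nomizu_ext => //.
- by apply: tangentB => //; apply: tangentZ.
- move=> i; have el := @eta_linear _ _ _ _ h3 i p.
  rewrite eta_nomizu_hor_r // (linear_atB el) //; last exact: tangentZ.
  rewrite eta_bracket_vertical // (linear_atZ _ el) // (linear_at_sum _ el tp).
  rewrite big1 ?mulr0 ?subr0 // => l _.
  by rewrite (eta_phi_hor h3 l i (tF tY)) // mulr0.
move=> Z tZ hZ; have gl := metric_linl gm (tF tZ).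
rewrite (linear_atB gl) ?(linear_atZ _ gl) ?(linear_at_sum _ gl tp) //;
  last exact: tangentZ.
have := koszul tX tY tZ; have := skew Z tZ hZ.
rewrite -(torsion_form_cycle tX tY tZ) (torsion_form_vertical tY tZ tX vX hZ).
have -> : bracket_form Y Z X = 2 * al * \sum_i eta S i p (F X)
  * met S p (phi S i p (F Y)) (F Z).
  rewrite (bracket_form_vertical tY tZ tX vX) mulr_sumr; apply: eq_bigr => i _.
  rewrite (eta_bracket (even_permE i) tY tZ) !hY (met_phi h3 i (tF tY) (tF tZ)).
  lra.
rewrite -/(bracket_form X Y Z); lra.
Qed.

(** On vertical vectors eta_i ([X, Y]) = 2 delta (eta_j /\ eta_k)(X, Y), while
    eta_i of the left-hand side is beta (eta_j /\ eta_k)(X, Y). All the terms of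
    the Koszul formula with horizontal Z vanish. *)
Lemma nomizu_ver_ver X Y : de != 0 -> tangent e X -> tangent e Y -> vertical X ->
  vertical Y ->
  vertical (bracket X Y) ->
  nomizu_vector X Y = (b / (2 * de)) *: F (bracket X Y).
Proof.
move=> de0 tX tY vX vY vb; have tb := tFb tX tY.
apply: nomizu_ext => //; first exact: tangentZ.
  move=> i; have ev := even_permE i; have ev3 := even_perm_rot (even_perm_rot ev).
  have el := @eta_linear _ _ _ _ h3 i p.
  rewrite (linear_atZ _ el) // (eta_nomizu ev tX tY) (eta_bracket ev tX tY).
  have tpY := phi_tangent h3 i (tF tY).
  rewrite (metric_sym gm (tF tX) tpY) (met_vert h3 tpY vX) (sum_even_perm _ ev).
  rewrite (eta_phi_id h3 i (tF tY)) (eta_phi_prev h3 ev (tF tY))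
    (eta_phi_next h3 ev3 (tF tY)).
  by field.
move=> Z tZ hZ; have gl := metric_linl gm (tF tZ).
rewrite (linear_atZ _ gl) // -/(bracket_form X Y Z).
have b0 : bracket_form X Y Z = 0.
  by rewrite /bracket_form (metric_sym gm tb (tF tZ)) (met_hor_vert h3 (tF tZ)
    hZ vb).
have := koszul tX tY tZ.
rewrite b0 (bracket_form_vertical tX tZ tY vY) big1; last first.
  by move=> i _; rewrite eta_bracket_vertical // mulr0.
rewrite (bracket_form_vertical tY tZ tX vX) big1; last first.
  by move=> i _; rewrite eta_bracket_vertical // mulr0.
rewrite -(torsion_form_cycle tX tY tZ) (torsion_form_vertical tY tZ tX vX hZ)
  (bracket_form_vertical tY tZ tX vX) big1; last first.
  by move=> i _; rewrite eta_bracket_vertical // mulr0.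
lra.
Qed.

End HomogeneousSasaki.
Arguments horizontal {R n d G M} S A p X.
Arguments vertical {R n d G M} S A p X.
Arguments bracket_form {R n d G M} S A p X Y Z.

(** * Reductive complements, the submersion and the theorem *)

Section ReductiveComplement.
Context {R : realType} {d k : nat} {G : lieGroup R d} {M : manifold R k}.
Context {A : smoothAction G M} {o : M} {m : set (vec G)}.
Hypothesis hm : reductive A o m.
Local Notation e := (lg_one G).

Lemma reductive_tangent X : m X -> tangent e X.
Proof. by have [+ _ _ _ _] := hm; apply. Qed.

Lemma reductive_lin t X Y : m X -> m Y -> m (t *: X + Y).
Proof. by have [_ [_ +] _ _ _] := hm; apply. Qed.

Lemma reductive0 : m 0. Proof. by have [_ [+ _] _ _ _] := hm. Qed.

Lemma reductiveZ t X : m X -> m (t *: X).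
Proof.
by move=> mX; rewrite -[t *: X]addr0; apply: reductive_lin => //; exact: reductive0.
Qed.

Lemma reductiveB X Y : m X -> m Y -> m (X - Y).
Proof. by move=> mX mY; rewrite addrC -scaleN1r; apply: reductive_lin. Qed.

Lemma reductive_sum (I : finType) (c : I -> R) (v : I -> vec G) :
  (forall i, m (v i)) -> m (\sum_i c i *: v i).
Proof.
move=> mv; apply: (big_ind m); first exact: reductive0.
  by move=> X Y mX mY; rewrite -[X]scale1r; apply: reductive_lin.
by move=> i _; apply: reductiveZ.
Qed.

Lemma reductive_inj X Y : m X -> m Y ->
  fundamental A X o = fundamental A Y o -> X = Y.
Proof.
move=> mX mY E; apply/eqP; rewrite -subr_eq0; apply/eqP.
have [_ _ _ + _] := hm; apply; last exact: reductiveB.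
by split; [apply: tangentB; exact: reductive_tangent|rewrite fundamentalB E subrr].
Qed.

Lemma reductive_decomp X : tangent e X ->
  exists2 Y, m Y & fundamental A Y o = fundamental A X o.
Proof.
move=> tX; have [_ _ /(_ X tX) + _ _] := hm.
by move=> [Y [Z [[_ Y0] mZ ->]]]; exists Z => //; rewrite fundamentalD Y0 add0r.
Qed.

Lemma to_mE X v : m X -> fundamental A X o = v -> to_m A o m v = X.
Proof.
move=> mX Xv; rewrite /to_m; case: xgetP => [Y _ [mY Yv]|/(_ X)[]//].
by apply: reductive_inj; rewrite // Yv.
Qed.

Lemma to_mP v : homogeneous A o -> tangent o v ->
  m (to_m A o m v) /\ fundamental A (to_m A o m v) o = v.
Proof.
move=> [_ ho] /ho[X tX Xv]; have [Y mY YX] := reductive_decomp tX.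
by rewrite (to_mE mY (etrans YX Xv)) YX.
Qed.

Lemma proj_mP X : tangent e X ->
  m (proj_m A o m X) /\ fundamental A (proj_m A o m X) o = fundamental A X o.
Proof.
move=> tX; have [Y mY YX] := reductive_decomp tX.
rewrite /proj_m; case: xgetP => [Z _ [mZ [_ Z0]]|/(_ Y)[]].
  by split=> //; apply/eqP; rewrite eq_sym -subr_eq0 -fundamentalB Z0.
split=> //; split; first by apply: tangentB => //; exact: reductive_tangent.
by rewrite fundamentalB YX subrr.
Qed.

Lemma nomizuE nab X Y : tangent e X -> tangent e Y ->
  nomizu A o m nab X Y = to_m A o m
    (nab (fundamental A X) (fundamental A Y) o + fundamental A (bracket X Y) o).
Proof.
by move=> tX tY; rewrite /nomizu lie_fundamental // bracketC fundamentalN opprK.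
Qed.

End ReductiveComplement.

Section Submersion.
Context {R : realType} {n d : nat} {G : lieGroup R d} {M : manifold R (4 * n + 3)}.
Context {S : contact3_data M} {A : smoothAction G M} {o : M}.
Context {N : manifold R (4 * n)} {gN : N -> vec N -> vec N -> R} {prN : M -> N}.
Context {AN : smoothAction G N}.
Hypothesis h3 : almost_3_contact_metric S.
Hypothesis hgN : riem_metric gN.
Hypothesis hsub : riem_submersion (met S) gN prN.
Hypothesis hver : forall p v, tangent p v ->
  (push prN v = 0 <-> vertical_space S p v).
Hypothesis hisoN : isometric AN gN.
Hypothesis hequi : forall a p, prN (A a p) = AN a (prN p).
Local Notation e := (lg_one G).
Local Notation F X := (fundamental A X o).
Local Notation FN X := (fundamental AN X (prN o)).
Implicit Types (X Y Z : vec G).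

Let sprN : smooth_map prN. Proof. by have [] := hsub. Qed.
Let tF X : tangent e X -> tangent o (F X). Proof. exact: fundamental_tangent. Qed.

Lemma push_fundamental_submersion X : push prN (F X) = FN X.
Proof.
rewrite /fundamental push_push //; congr (push _ X).
by apply/funext => a; rewrite hequi.
Qed.

(** The vertical part of u is annihilated by the differential and orthogonal to
    v. *)
Lemma base_metric_push p u v : tangent p u -> tangent p v ->
  (forall i, eta S i p v = 0) ->
  gN (prN p) (push prN u) (push prN v) = met S p u v.
Proof.
move=> tu tv hv; have [_ _ _ iso] := hsub; have gm := contact3_metric h3.
have normal w : tangent p w -> (forall i, eta S i p w = 0) ->
    tangent p w /\ (forall v', tangent p v' -> push prN v' = 0 -> met S p w v' = 0).
  by move=> tw hw; split=> // v' tv' /(hver tv'); apply: (met_hor_vert h3 tw hw).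
pose w := \sum_i eta S i p u *: xi S i p.
have vw : vertical_space S p w by exists (fun i => eta S i p u).
have tw := vertical_tangent h3 vw.
have uE : u = 1 *: w + horizontal_part (S := S) p u.
  by rewrite scale1r /horizontal_part -/w addrC subrK.
have th := horizontal_part_tangent h3 tu.
have -> : push prN u = push prN (horizontal_part (S := S) p u).
  by rewrite {1}uE push_lin ((hver tw).2 vw) scaler0 add0r.
rewrite iso; [|apply: normal => // i; exact: eta_horizontal_part|exact: normal].
have -> : met S p u v = met S p (w + horizontal_part (S := S) p u) v.
  by rewrite {1}uE scale1r.
rewrite (linear_atD (metric_linl gm tv) tw th).
by rewrite (metric_sym gm tw tv) (met_hor_vert h3 tv hv vw) add0r.
Qed.

Lemma bracket_form_base X Y Z : tangent e X -> tangent e Y -> tangent e Z ->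
  horizontal S A o Z ->
  gN (prN o) (FN (bracket X Y)) (FN Z) = bracket_form S A o X Y Z.
Proof.
move=> tX tY tZ hZ; rewrite -!push_fundamental_submersion base_metric_push //;
  last exact: tF.
by apply/tF/bracket_tangent.
Qed.

(** The field of X on the base vanishes at the base point, so the Killing
    equation has no derivative term there. *)
Lemma vertical_skew X Y Z : tangent e X -> tangent e Y -> tangent e Z ->
  vertical S A o X -> horizontal S A o Y -> horizontal S A o Z ->
  bracket_form S A o X Y Z + bracket_form S A o X Z Y = 0.
Proof.
move=> tX tY tZ vX hY hZ; rewrite -!bracket_form_base //.
have X0 : FN X = 0 by rewrite -push_fundamental_submersion; apply/(hver (tF tX)).
have := killing hgN (prN o) hisoN tX tY tZ.
have tN W : tangent e W -> tangent (prN o) (FN W) by apply: fundamental_tangent.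
rewrite X0 (metric_sym hgN (tN _ tY) (tN _ (bracket_tangent tX tZ))).
rewrite -[LHS]/(0 : R); lra.
Qed.

(** The bracket of two fields that vanish at a point vanishes there. *)
Lemma vertical_bracket X Y : tangent e X -> tangent e Y ->
  vertical S A o X -> vertical S A o Y ->
  vertical S A o (bracket X Y).
Proof.
move=> tX tY vX vY; rewrite bracketC /vertical fundamentalN.
have tb : tangent o (F (bracket Y X)) by apply/tF/bracket_tangent.
suff : FN (bracket Y X) = 0.
  rewrite -push_fundamental_submersion => /(hver tb) [c ->].
  by exists (fun i => - c i); rewrite -sumrN; apply: eq_bigr => i _;
    rewrite scaleNr.
rewrite -lie_fundamental //.
have X0 : FN X = 0 by rewrite -push_fundamental_submersion; apply/(hver (tF tX)).
have Y0 : FN Y = 0 by rewrite -push_fundamental_submersion; apply/(hver (tF tY)).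
apply/funext => f; rewrite /lie /on_smooth X0 Y0; case: asboolP => // _.
by rewrite -[LHS]/(0 - 0 : R) subrr.
Qed.

End Submersion.

Unset Implicit Arguments.

Theorem theorem4p1p1 (R : realType) (n d : nat) (alpha delta : R)
  (G : lieGroup R d)
  (M : manifold R (4 * n + 3)) (S : contact3_data M)
  (hS : sasaki3 S alpha delta) (hdelta : delta != 0)
  (A : smoothAction G M) (o : M)
  (hA : homogeneous A o) (hiso : isometric A (met S)) (hpres : preserves3 A S)
  (m : set (vec G)) (hm : reductive A o m)
  (N : manifold R (4 * n))
  (gN : N -> vec N -> vec N -> R)
  (hgN : riem_metric gN)
  (prN : M -> N) (hsub : riem_submersion (met S) gN prN)
  (hver : forall p v, tangent p v ->
     (push prN v = 0 <-> vertical_space S p v))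
  (AN : smoothAction G N) (hAN : homogeneous AN (prN o))
  (hisoN : isometric AN gN)
  (hequi : forall a p, prN (A a p) = AN a (prN p))
  (hH : reductive AN (prN o) (hor_m A S o m))
  (nab : (M -> vec M) -> (M -> vec M) -> M -> vec M)
  (hnab : canonical_connection S alpha delta nab)
  (nabN : (N -> vec N) -> (N -> vec N) -> N -> vec N)
  (hnabN : levi_civita gN nabN) :
  let V := vert_m A S o m in
  let H := hor_m A S o m in
  [/\ forall X Y, H X -> H Y ->
        nomizu A o m nab X Y = nomizu AN (prN o) H nabN X Y,
      forall X Y, V X -> V Y ->
        nomizu A o m nab X Y =
          (beta alpha delta / (2 * delta)) *: proj_m A o m (bracket X Y),
      forall X Y, V X -> H Y ->
        nomizu A o m nab X Y =
          proj_m A o m (bracket X Y)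
          - (2 * alpha) *: \sum_i eta_m A S o i X *: phi_m A S o m i Y &
      forall X Y, H X -> V Y -> nomizu A o m nab X Y = 0].
Proof.
have [_ h3 _] := hS; have gm := contact3_metric h3.
have [_ lift] := hA.
move=> V H.
have tm X : m X -> tangent (lg_one G) X by apply: (reductive_tangent hm).
have VP X : V X -> [/\ m X, tangent (lg_one G) X & vertical S A o X].
  by move=> [mX vX]; split=> //; apply: tm.
have HP X : H X -> [/\ m X, tangent (lg_one G) X & horizontal S A o X].
  by move=> [mX [_ hX]]; split=> //; apply: tm.
have skew := vertical_skew h3 hgN hsub hver hisoN hequi.
have tproj X Y : tangent (lg_one G) X -> tangent (lg_one G) Y ->
    m (proj_m A o m (bracket X Y)) /\
    fundamental A (proj_m A o m (bracket X Y)) o = fundamental A (bracket X Y) o.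
  by move=> tX tY; apply: (proj_mP hm); apply: bracket_tangent.
split=> X Y.
- move=> /HP[mX tX hX] /HP[mY tY hY]; rewrite !nomizuE //.
  set u := _ + fundamental A _ o; set uN := _ + fundamental AN _ _.
  have tu : tangent o u := nomizu_vector_tangent hnab tX tY.
  have eu i : Defs.eta S i o u = 0 := eta_nomizu_hor_l hS hpres hnab i tX tY hX.
  have [mW Wu] := to_mP hm hA tu; set W := to_m A o m u in mW Wu *.
  have HW : H W by split=> //; rewrite Wu.
  have [mcN torN0] := hnabN.
  have tuN : tangent (prN o) uN.
    apply: tangentD; last by apply/fundamental_tangent/bracket_tangent.
    by have [[nv _ _ _] _] := mcN; apply: (nv _ _ _ _).1; apply: fundamental_vfield.
  have sprN : smooth_map prN by have [] := hsub.
  have tpu : tangent (prN o) (push prN u) by apply: push_tangent.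
  have skN : skew_torsion gN nabN.
    move=> X0 Y0 Z0 q vX vY vZ; rewrite !torN0 //.
    by rewrite (linear_at0 (metric_linl hgN (vZ.1 q)))
      (linear_at0 (metric_linl hgN (vY.1 q))) oppr0.
  rewrite (to_mE hH HW) //.
  rewrite -(push_fundamental_submersion (o := o) hsub hequi) Wu.
  apply: (metric_eq hgN tpu tuN).
  (* Tangent vectors of the base at prN o are projections of horizontal ones. *)
  have [_ liftN] := hAN; have [Z0 tZ0 <-] := liftN _ (tangentB tpu tuN).
  have [Z /HP[mZ tZ hZ] <-] := reductive_decomp hH tZ0.
  have E1 := koszul (p := o) hS hiso hnab tX tY tZ.
  have E2 := nomizu_koszul hgN (prN o) hisoN mcN skN tX tY tZ.
  move: E1; rewrite (torsion_form_hor0 hS hiso hpres hnab lift tX tY tZ hX hY hZ)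
    -[nomizu_vector X Y]/u.
  move: E2; rewrite -/uN torN0 //; try exact: fundamental_vfield.
  have tZN : tangent (prN o) (fundamental AN Z (prN o))
    by apply: fundamental_tangent.
  rewrite (linear_at0 (metric_linl hgN tZN)).
  rewrite !(bracket_form_base h3 hsub hver hequi) //.
  rewrite -!(push_fundamental_submersion hsub hequi).
  rewrite (base_metric_push h3 hsub hver tu (fundamental_tangent A o tZ) hZ) =>
    E2 E1.
  lra.
- move=> /VP[mX tX vX] /VP[mY tY vY]; rewrite nomizuE //.
  have [mb bE] := tproj X Y tX tY.
  apply: (to_mE hm); first exact: (reductiveZ hm).
  rewrite fundamentalZ bE.
  have vb := vertical_bracket hsub hver hequi tX tY vX vY.
  by have := nomizu_ver_ver hS hiso hpres hnab lift hdelta tX tY vX vY vb.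
- move=> /VP[mX tX vX] /HP[mY tY hY]; rewrite nomizuE //.
  have [mb bE] := tproj X Y tX tY.
  have pP i : m (phi_m A S o m i Y) /\
      fundamental A (phi_m A S o m i Y) o = phi S i o (fundamental A Y o).
    by apply: (to_mP hm hA); apply: (phi_tangent h3); apply: fundamental_tangent.
  apply: (to_mE hm).
    by apply: (reductiveB hm) => //;
      apply/(reductiveZ hm)/(reductive_sum hm) => i; case: (pP i).
  rewrite fundamentalB fundamentalZ bE fundamental_sum.
  under [in LHS]eq_bigr => i _ do rewrite (pP i).2.
  apply: esym; apply: (nomizu_ver_hor hS hiso hpres hnab lift tX tY vX hY).
  by move=> Z tZ hZ; apply: skew.
- move=> /HP[mX tX hX] /VP[mY tY vY]; rewrite nomizuE //.
  apply: (to_mE hm); first exact: (reductive0 hm).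
  rewrite fundamental0; apply: esym.
  apply: (nomizu_hor_ver hS hiso hpres hnab lift tX tY hX vY).
  by move=> Z tZ hZ; apply: skew.
Qed.
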